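(* Let $f\in C(I,I)$ with $h(f)=0$. Then $f$ has no $3$-scrambled tuple.
   Context: $I=[0,1]$, $C(I,I)$ continuous self-maps of $I$, $h(f)$ topological entropy. For $n\ge2$, a tuple $\langle x_1,\dots,x_n\rangle\in I^n$ is $n$-scrambled if $\liminf_{k\to\infty}\max_{1\le i<j\le n}|f^k(x_i)-f^k(x_j)|=0$ and $\limsup_{k\to\infty}\min_{1\le i<j\le n}|f^k(x_i)-f^k(x_j)|>0$. *)

(* Defs.v *)
From Stdlib Require Import Reals Lra Lia List.
Open Scope R_scope.

Definition inI (x : R) : Prop := 0 <= x <= 1.

(* f : I -> I continuous, represented by f : R -> R mapping I into I and
   continuous on I (relative topology). Values outside I are irrelevant. *)
Definition cont_self_map_I (f : R -> R) : Prop :=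
  (forall x, inI x -> inI (f x)) /\
  (forall x, inI x -> forall eps, eps > 0 ->
     exists delta, delta > 0 /\
       forall y, inI y -> Rabs (y - x) < delta -> Rabs (f y - f x) < eps).

Definition iter (f : R -> R) (k : nat) (x : R) : R := Nat.iter k f x.

Definition n_eps_sep (f : R -> R) (n : nat) (eps x y : R) : Prop :=
  exists k, (k < n)%nat /\ Rabs (iter f k x - iter f k y) > eps.

Definition separated_set (f : R -> R) (n : nat) (eps : R) (L : list R) : Prop :=
  NoDup L /\ (forall x, In x L -> inI x) /\
  (forall x y, In x L -> In y L -> x <> y -> n_eps_sep f n eps x y).

(* h(f) = 0 (Bowen's definition: h(f) = sup_{eps>0} limsup_n (1/n) log s(n,eps),
   s(n,eps) = maximal cardinality of an (n,eps)-separated set; since h >= 0,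
   h(f) = 0 iff for every eps>0 and delta>0, eventually s(n,eps) <= exp(delta n)). *)
Definition zero_entropy (f : R -> R) : Prop :=
  forall eps, eps > 0 -> forall delta, delta > 0 ->
    exists N : nat, forall n : nat, (N <= n)%nat ->
      forall L, separated_set f n eps L -> INR (length L) <= exp (delta * INR n).

Definition dmax3 (f : R -> R) (k : nat) (x1 x2 x3 : R) : R :=
  Rmax (Rabs (iter f k x1 - iter f k x2))
       (Rmax (Rabs (iter f k x1 - iter f k x3)) (Rabs (iter f k x2 - iter f k x3))).
Definition dmin3 (f : R -> R) (k : nat) (x1 x2 x3 : R) : R :=
  Rmin (Rabs (iter f k x1 - iter f k x2))
       (Rmin (Rabs (iter f k x1 - iter f k x3)) (Rabs (iter f k x2 - iter f k x3))).

(* <x1,x2,x3> in I^3 is 3-scrambled: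
   liminf_k dmax3 = 0 (the sequence is >= 0) and limsup_k dmin3 > 0. *)
Definition scrambled3 (f : R -> R) (x1 x2 x3 : R) : Prop :=
  inI x1 /\ inI x2 /\ inI x3 /\
  (forall eps, eps > 0 -> forall N : nat, exists k, (N <= k)%nat /\ dmax3 f k x1 x2 x3 < eps) /\
  (exists c, c > 0 /\ forall N : nat, exists k, (N <= k)%nat /\ dmin3 f k x1 x2 x3 > c).

(* Main.v *)
Require Import Defs.
From Stdlib Require Import Reals Lra Lia List Classical.
Open Scope R_scope.

(** Zero entropy forbids two adjacent intervals that iterates of the map stretch over
    their union. For an orbit that is not asymptotically periodic this forces it to jump
    alternately left and right of some fixed point. Applied to all powers f^p, it
    organises the orbit in a period doubling pattern, in which proximal orbits are in phase.
    Suppose that x_k, y_k, z_k are infinitely often near a < b < d in this order. These visit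
    times are eventually congruent modulo every power of 2, so two visits of y to (a, d)
    cannot both be in the limiting residue class. For a visit y_k
    that is not, some f^i maps y_k to the side of a periodic point q where a and d lie, but
    maps a and d across q. This folding yields a pair of intervals as excluded above. *)

(** Three orbits are essential, since zero entropy allows scrambled pairs. Up to reflection, the
    fold cuts an interval at a point between [a] and the middle orbit, and each half needs a point
    sent to the far end: one at or near [a] for the left half, [d] for the right one. Visits are
    congruent because otherwise all three orbits would lie on opposite sides of a periodic point at
    two visits, although at both the first orbit is near [a] and the third near [d]. Two given
    visits are incongruent modulo any power of 2 exceeding their distance. Convergence to a periodic
    orbit has to be treated apart, as alternation may then fail; but proximal orbits of this kind
    are asymptotic, which rules out separation. *)

(** * Frequent and eventual properties, iterates, lower limits *)

Definition freq (P : nat -> Prop) := forall N, exists k, (N <= k)%nat /\ P k.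
Definition evt (P : nat -> Prop) := exists N, forall k, (N <= k)%nat -> P k.

Lemma not_freq (P : nat -> Prop) : ~ freq P -> evt (fun k => ~ P k).
Proof.
  intros H. apply NNPP. intros H1. apply H. intros N.
  apply NNPP. intros H2. apply H1. exists N. intros k Hk HP.
  apply H2. now exists k.
Qed.

Lemma freq_evt (P Q : nat -> Prop) : freq P -> evt Q -> freq (fun k => P k /\ Q k).
Proof.
  intros HP [N HQ] M. destruct (HP (Nat.max N M)) as [k [Hk Pk]].
  exists k. split; [lia|]. split; auto. apply HQ; lia.
Qed.

Lemma evt_and (P Q : nat -> Prop) : evt P -> evt Q -> evt (fun k => P k /\ Q k).
Proof.
  intros [N HP] [M HQ]. exists (Nat.max N M). intros k Hk.
  split; [apply HP | apply HQ]; lia.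
Qed.

Lemma iter_plus g m n x : iter g (m + n) x = iter g m (iter g n x).
Proof.
  induction m as [|m IH]; [reflexivity|].
  change (g (iter g (m + n) x) = g (iter g m (iter g n x))). now rewrite IH.
Qed.

Lemma iter_mult g m n x : iter (iter g m) n x = iter g (n * m) x.
Proof.
  induction n as [|n IH]; [reflexivity|].
  change (iter g m (iter (iter g m) n x) = iter g (m + n * m) x).
  now rewrite IH, iter_plus.
Qed.

Lemma iter_fixed g c n : g c = c -> iter g n c = c.
Proof.
  intros H. induction n as [|n IH]; [reflexivity|].
  change (g (iter g n c) = c). now rewrite IH.
Qed.

Lemma iter_continuity g n : continuity g -> continuity (iter g n).
Proof.
  intros H. induction n as [|n IH].
  - intros x. apply derivable_continuous_pt, derivable_pt_id.
  - intros x. exact (continuity_pt_comp (iter g n) g x (IH x) (H _)).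
Qed.

Lemma continuity_eps g x eps : continuity g -> 0 < eps ->
  exists d, 0 < d /\ forall y, Rabs (y - x) < d -> Rabs (g y - g x) < eps.
Proof.
  intros H He. destruct (H x eps He) as [d [Hd H1]]. exists d. split; [exact Hd|].
  intros y Hy. destruct (Req_dec x y) as [->|Hne].
  - now rewrite Rminus_diag, Rabs_R0.
  - apply H1. split; [split; [exact I|exact Hne]|exact Hy].
Qed.

Lemma ivt g a b y : continuity g -> g a <= y -> y <= g b ->
  exists x, Rmin a b <= x <= Rmax a b /\ g x = y.
Proof.
  intros Hg Ha Hb.
  assert (Hc : continuity (fun t => g t - y)).
  { intros t. apply continuity_pt_minus; [apply Hg|].
    apply continuity_pt_const. now intros u v. }
  assert (Hab : Rmin a b <= Rmax a b)
    by (apply Rle_trans with a; [apply Rmin_l|apply Rmax_l]).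
  destruct (IVT_cor _ _ _ Hc Hab) as [z [Hz Hz0]].
  - unfold Rmin, Rmax. destruct (Rle_dec a b); nra.
  - exists z. split; [exact Hz|lra].
Qed.

(** [P] is a decreasing family of nonempty sets rather than the tails alone, because [joint_cluster]
    takes a second lower limit along the times at which another sequence is close to its own. *)
Lemma filter_liminf (P : nat -> nat -> Prop) (u : nat -> R) (M : R) :
  (forall n, exists k, P n k) ->
  (forall n m k, (n <= m)%nat -> P m k -> P n k) ->
  (forall k, Rabs (u k) <= M) ->
  exists a, (forall eps, 0 < eps -> exists n, forall k, P n k -> a - eps < u k) /\
            (forall eps, 0 < eps -> forall n, exists k, P n k /\ u k < a + eps).
Proof.
  intros Hex Hmono HM.
  assert (HMk : forall k, - M <= u k <= M).
  { intros k. specialize (HM k). unfold Rabs in HM. destruct (Rcase_abs (u k)); lra. }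
  destruct (completeness (fun t => exists n, forall k, P n k -> t <= u k)) as [a [Hub Hlub]].
  - exists M. intros t [n Ht]. destruct (Hex n) as [k Hk].
    specialize (Ht k Hk). specialize (HMk k). lra.
  - exists (- M). exists 0%nat. intros k _. apply HMk.
  - exists a. split.
    + intros eps He. apply NNPP. intros Hn.
      assert (a <= a - eps); [|lra].
      apply Hlub. intros t [n Ht]. destruct (Rle_lt_dec t (a - eps)) as [|Hlt]; [assumption|].
      exfalso. apply Hn. exists n. intros k Hk. specialize (Ht k Hk). lra.
    + intros eps He n. apply NNPP. intros Hn.
      assert (a + eps <= a); [|lra].
      apply Hub. exists n. intros k Hk. apply Rnot_lt_le. intros Hlt.
      apply Hn. now exists k.
Qed.

Definition is_liminf (u : nat -> R) (a : R) :=
  (forall eps, 0 < eps -> evt (fun k => a - eps < u k)) /\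
  (forall eps, 0 < eps -> freq (fun k => u k < a + eps)).

Definition bdd g x := exists M, forall k, Rabs (iter g k x) <= M.

Lemma liminf_ex g x : bdd g x -> exists a, is_liminf (fun k => iter g k x) a.
Proof.
  intros [M HM].
  destruct (filter_liminf (fun n k => (n <= k)%nat) (fun k => iter g k x) M) as [a [H1 H2]].
  - intros n; exists n; lia.
  - intros; lia.
  - exact HM.
  - exists a. split; assumption.
Qed.

(** * Conjugation by x -> -x *)

Definition mirror g (x : R) := - g (- x).

Lemma iter_mirror g k x : iter (mirror g) k x = - iter g k (- x).
Proof.
  induction k as [|k IH].
  - change (x = - - x). ring.
  - change (- g (- iter (mirror g) k x) = - g (iter g k (- x))).
    rewrite IH. now rewrite Ropp_involutive.
Qed.

Lemma iter_mirror_opp g k x : iter (mirror g) k (- x) = - iter g k x.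
Proof. now rewrite iter_mirror, Ropp_involutive. Qed.

Lemma mirror_fixed g c : g c = c -> mirror g (- c) = - c.
Proof. intros H. unfold mirror. now rewrite Ropp_involutive, H. Qed.

Lemma bdd_mirror g x : bdd g x -> bdd (mirror g) (- x).
Proof. intros [M H]. exists M. intros k. rewrite iter_mirror_opp, Rabs_Ropp. apply H. Qed.

Lemma bdd_shift g x n : bdd g x -> bdd g (iter g n x).
Proof. intros [M H]. exists M. intros k. rewrite <- iter_plus. apply H. Qed.

Lemma bdd_iter g x m : bdd g x -> bdd (iter g m) x.
Proof. intros [M H]. exists M. intros k. rewrite iter_mult. apply H. Qed.

(* The inequalities say that [g ^ s] maps [e1, c], and [g ^ t] maps [c, e2], onto an interval
   containing [e1, e2]. Different exponents are harmless: [s + t] then works for both halves. *)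
Definition no_horseshoe (g : R -> R) :=
  forall e1 e2 c s t p1 q1 p2 q2, e1 < e2 ->
    e1 <= p1 <= c -> e1 <= q1 <= c -> c <= p2 <= e2 -> c <= q2 <= e2 ->
    iter g s p1 <= e1 -> e2 <= iter g s q1 ->
    iter g t p2 <= e1 -> e2 <= iter g t q2 -> False.

Definition good g := continuity g /\ no_horseshoe g.

Lemma good_mirror g : good g -> good (mirror g).
Proof.
  intros [Hc Hh]. split.
  - intros x. unfold mirror. apply continuity_pt_opp.
    apply (continuity_pt_comp (fun t => - t) g); [|apply Hc].
    apply continuity_pt_opp, derivable_continuous_pt, derivable_pt_id.
  - intros e1 e2 c s t p1 q1 p2 q2 He H1 H2 H3 H4 H5 H6 H7 H8.
    rewrite iter_mirror in *.
    apply (Hh (- e2) (- e1) (- c) t s (- q2) (- p2) (- q1) (- p1)); lra.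
Qed.

Lemma good_iter g m : good g -> good (iter g m).
Proof.
  intros [Hc Hh]. split; [now apply iter_continuity|].
  intros e1 e2 c s t p1 q1 p2 q2 He H1 H2 H3 H4 H5 H6 H7 H8.
  rewrite iter_mult in *. eapply (Hh e1 e2 c _ _ p1 q1 p2 q2); eassumption.
Qed.

(** * Asymptotically periodic orbits *)

(** One convergent residue class suffices: for continuous [g] the other classes converge to iterates
    of [l], and [l] is fixed by [g ^ t] ([ap_limit_fixed]). *)
Definition asymp_periodic g x :=
  exists t l, (1 <= t)%nat /\ Un_cv (fun j => iter g (t * j) x) l.

Lemma Un_cv_continuity g u l : continuity g -> Un_cv u l -> Un_cv (fun j => g (u j)) (g l).
Proof. intros Hg Hu. apply (continuity_seq g u l (Hg l) Hu). Qed.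

Lemma ap_unshift g x n : continuity g -> asymp_periodic g (iter g n x) -> asymp_periodic g x.
Proof.
  intros Hg [t [l [Ht Hl]]]. exists t, (iter g (t * n - n) l). split; [exact Ht|].
  apply (CV_shift _ n).
  apply Un_cv_ext with (fun j => iter g (t * n - n) (iter g (t * j) (iter g n x))).
  - intros j. rewrite <- !iter_plus. f_equal. nia.
  - apply Un_cv_continuity; [now apply iter_continuity|exact Hl].
Qed.

Lemma ap_iter g x m : (1 <= m)%nat -> asymp_periodic (iter g m) x -> asymp_periodic g x.
Proof.
  intros Hm [t [l [Ht Hl]]]. exists (t * m)%nat, l. split; [nia|].
  apply Un_cv_ext with (2 := Hl). intros j. rewrite iter_mult. f_equal. nia.
Qed.

Lemma ap_mirror g x : asymp_periodic (mirror g) (- x) -> asymp_periodic g x.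
Proof.
  intros [t [l [Ht Hl]]]. exists t, (- l). split; [exact Ht|].
  apply Un_cv_ext with (2 := CV_opp _ _ Hl). intros j.
  unfold opp_seq. rewrite iter_mirror_opp. ring.
Qed.

Lemma nap_ne g x c k : ~ asymp_periodic g x -> g c = c -> iter g k x <> c.
Proof.
  intros Hn Hc Hk. apply Hn. exists 1%nat, c. split; [lia|].
  intros eps He. exists k. intros n Hnk. unfold Rdist.
  replace (1 * n)%nat with ((n - k) + k)%nat by lia.
  rewrite iter_plus, Hk, iter_fixed by exact Hc.
  now rewrite Rminus_diag, Rabs_R0.
Qed.

Lemma cv_monotone_ap g x t n : continuity g -> bdd g x -> (1 <= t)%nat ->
  (forall j, iter g (n + t * j) x <= iter g (n + t * S j) x) -> asymp_periodic g x.
Proof.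
  intros Hg [M HM] Ht Hm. apply (ap_unshift g x n Hg).
  destruct (growing_cv (fun j => iter g (t * j) (iter g n x))) as [l Hl].
  - intros j. rewrite <- !iter_plus, !(Nat.add_comm _ n). apply Hm.
  - exists M. intros y [j ->]. rewrite <- iter_plus.
    eapply Rle_trans; [apply Rle_abs|apply HM].
  - now exists t, l.
Qed.

Lemma freq_impl (P Q : nat -> Prop) : (forall k, P k -> Q k) -> freq P -> freq Q.
Proof. intros H HP N. destruct (HP N) as [k [Hk Pk]]. exists k. auto. Qed.

Lemma evt_impl (P Q : nat -> Prop) : (forall k, P k -> Q k) -> evt P -> evt Q.
Proof. intros H [N HP]. exists N. auto. Qed.

Lemma evt_S (P : nat -> Prop) : evt P -> evt (fun k => P (S k)).
Proof. intros [N HP]. exists N. auto. Qed.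

Lemma freq_shift (P : nat -> Prop) n : freq P -> freq (fun k => P (k + n)%nat).
Proof.
  intros H N. destruct (H (N + n)%nat) as [k [Hk Pk]]. exists (k - n)%nat.
  split; [lia|]. now replace (k - n + n)%nat with k by lia.
Qed.

Lemma is_liminf_mirror g x b : is_liminf (fun k => iter (mirror g) k (- x)) (- b) ->
  (forall eps, 0 < eps -> evt (fun k => iter g k x < b + eps)) /\
  (forall eps, 0 < eps -> freq (fun k => b - eps < iter g k x)).
Proof.
  intros [H1 H2]. split; intros eps He.
  - eapply evt_impl; [|exact (H1 eps He)]. intros k Hk. cbv beta in Hk.
    rewrite iter_mirror_opp in Hk. lra.
  - eapply freq_impl; [|exact (H2 eps He)]. intros k Hk. cbv beta in Hk.
    rewrite iter_mirror_opp in Hk. lra.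
Qed.

Lemma liminf_lt_limsup g x a b : ~ asymp_periodic g x ->
  is_liminf (fun k => iter g k x) a ->
  is_liminf (fun k => iter (mirror g) k (- x)) (- b) -> a < b.
Proof.
  intros Hn [H1 H2] Hb. apply is_liminf_mirror in Hb. destruct Hb as [H3 H4].
  apply Rnot_le_lt. intros Hba. apply Hn. exists 1%nat, a. split; [lia|].
  intros eps He. destruct (evt_and _ _ (H1 eps He) (H3 eps He)) as [N HN].
  exists N. intros n Hnn. destruct (HN (1 * n)%nat) as [HA HB]; [lia|].
  unfold Rdist. apply Rabs_def1; lra.
Qed.

(** * Alternation about a fixed point *)

(** If the sides differed, some [y] between [v] and [v'] would be sent to [c] and stay there, while
    [v] and [v'] keep returning to height [e]. The intervals from [y] to either point then both
    stretch over [c, e]. *)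
Lemma same_side_above g c e v v' s : good g -> g c = c -> c < v <= e -> c < v' <= e ->
  freq (fun k => e <= iter g k v) -> freq (fun k => e <= iter g k v') ->
  iter g s v < c -> c < iter g s v' -> False.
Proof.
  intros [Hc Hh] Hfix Hv Hv' Fv Fv' H1 H2.
  destruct (ivt (iter g s) v v' c (iter_continuity g s Hc)) as [y [Hy Hyc]]; [lra|lra|].
  assert (Hland : forall k, (s <= k)%nat -> iter g k y = c).
  { intros k Hk. replace k with ((k - s) + s)%nat by lia.
    now rewrite iter_plus, Hyc, iter_fixed. }
  destruct (Fv s) as [k [Hk Fk]]. destruct (Fv' s) as [k' [Hk' Fk']].
  pose proof (Hland k Hk) as E. pose proof (Hland k' Hk') as E'.
  unfold Rmin, Rmax in Hy. destruct (Rle_dec v v').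
  - apply (Hh c e y k k' y v y v'); lra.
  - apply (Hh c e y k' k y v' y v); lra.
Qed.

Lemma same_side_below g c e v v' s : good g -> g c = c -> e <= v < c -> e <= v' < c ->
  freq (fun k => iter g k v <= e) -> freq (fun k => iter g k v' <= e) ->
  iter g s v < c -> c < iter g s v' -> False.
Proof.
  intros Hg Hfix Hv Hv' Fv Fv' H1 H2.
  apply (same_side_above (mirror g) (- c) (- e) (- v') (- v) s).
  - now apply good_mirror.
  - now apply mirror_fixed.
  - lra.
  - lra.
  - eapply freq_impl; [|exact Fv']. intros k Hk. cbv beta in *. rewrite iter_mirror_opp. lra.
  - eapply freq_impl; [|exact Fv]. intros k Hk. cbv beta in *. rewrite iter_mirror_opp. lra.
  - rewrite iter_mirror_opp. lra.
  - rewrite iter_mirror_opp. lra.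
Qed.

Lemma last_before (P : nat -> Prop) i j : (i <= j)%nat -> P i -> ~ P j ->
  exists k, (i <= k < j)%nat /\ P k /\ forall l, (k < l <= j)%nat -> ~ P l.
Proof.
  intros Hij Pi. induction Hij as [|j Hij IH]; intros Hj; [contradiction|].
  destruct (classic (P j)) as [Pj|nPj].
  - exists j. repeat split; [lia|lia|exact Pj|].
    intros l Hl. now replace l with (S j) by lia.
  - destruct (IH nPj) as [k [Hk [Pk Hl]]]. exists k. repeat split; [lia|lia|exact Pk|].
    intros l Hlk. destruct (Nat.eq_dec l (S j)) as [->|]; [exact Hj|]. apply Hl. lia.
Qed.

(* Otherwise the liminf [a] would be a fixed point. Leaving a neighbourhood of [a]
   from below takes at least two steps just above [a], and the two corresponding
   points then have the same side of [a] for ever, as do their successors. *)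
Lemma evt_not_two_below_liminf g x a : good g -> bdd g x -> ~ asymp_periodic g x ->
  is_liminf (fun k => iter g k x) a ->
  evt (fun k => ~ (iter g k x <= a /\ iter g (S k) x <= a)).
Proof.
  intros Hg Hb Hn Ha. apply not_freq. intros HF.
  assert (Hfix : g a = a).
  { apply cond_eq. intros eps He.
    destruct (continuity_eps g a (eps / 2) (proj1 Hg)) as [d [Hd Hcont]]; [lra|].
    destruct (freq_evt _ _ HF (evt_and _ _ (proj1 Ha d Hd)
      (evt_S _ (proj1 Ha (eps / 2) ltac:(lra)))) 0%nat) as [k [_ [[H1 H2] [H3 H4]]]].
    cbv beta in *. assert (Hk : Rabs (iter g k x - a) < d) by (apply Rabs_def1; lra).
    apply Hcont in Hk. change (g (iter g k x)) with (iter g (S k) x) in Hk.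
    apply Rabs_def2 in Hk. apply Rabs_def1; lra. }
  destruct (liminf_ex (mirror g) (- x)) as [b' Hb']; [now apply bdd_mirror|].
  rewrite <- (Ropp_involutive b') in Hb'. set (b := - b') in *.
  pose proof (liminf_lt_limsup g x a b Hn Ha Hb') as Hab.
  apply is_liminf_mirror in Hb'. destruct Hb' as [_ Hb2].
  set (c := (a + b) / 2). assert (Hac : a < c < b) by (unfold c; lra).
  assert (Hfc : forall n, freq (fun k => c <= iter g k (iter g n x))).
  { intros n. eapply freq_impl; [|exact (freq_shift _ n (Hb2 (b - c) ltac:(lra)))].
    intros k Hk. cbv beta in *. rewrite <- iter_plus. lra. }
  (* Two nested tolerances: a point within [d'] of [a] has its image within [d] of [a] and below
     [c], and the image after that is below [c] too. This yields two consecutive points in (a,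
     c). *)
  destruct (continuity_eps g a (c - a) (proj1 Hg)) as [d [Hd Hcd]]; [lra|].
  destruct (continuity_eps g a (Rmin d (c - a)) (proj1 Hg)) as [d' [Hd' Hcd']].
  { apply Rmin_glb_lt; lra. }
  destruct (proj1 Ha d' Hd') as [N0 HN0].
  destruct (HF N0) as [k1 [Hk1 [Hk1a _]]].
  destruct (Hfc 0%nat k1) as [k2 [Hk2 Hk2c]].
  change (iter g 0 x) with x in Hk2c.
  destruct (last_before (fun k => iter g k x <= a) k1 k2) as [j [Hj [Hja Hjl]]];
    [exact Hk2|exact Hk1a|lra|].
  assert (Hup : forall l, (j < l <= k2)%nat -> a < iter g l x)
    by (intros l Hl; apply Rnot_le_lt, Hjl, Hl).
  assert (Hj1 : Rabs (iter g (S j) x - a) < Rmin d (c - a)).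
  { pose proof (Hcd' (iter g j x)) as H. rewrite Hfix in H. apply H.
    specialize (HN0 j ltac:(lia)). cbv beta in HN0. apply Rabs_def1; lra. }
  assert (Hj1d : Rabs (iter g (S j) x - a) < d)
    by (eapply Rlt_le_trans; [exact Hj1|apply Rmin_l]).
  assert (Hj1c : iter g (S j) x < c).
  { assert (H : Rabs (iter g (S j) x - a) < c - a)
      by (eapply Rlt_le_trans; [exact Hj1|apply Rmin_r]).
    apply Rabs_def2 in H. lra. }
  assert (Hj2 : iter g (S (S j)) x < c).
  { apply Hcd in Hj1d. rewrite Hfix in Hj1d. apply Rabs_def2 in Hj1d.
    change (iter g (S (S j)) x) with (g (iter g (S j) x)). lra. }
  assert (Hne : S j <> k2) by (intros E; rewrite E in Hj1c; lra).
  pose proof (Hup (S j) ltac:(lia)) as Hu1. pose proof (Hup (S (S j)) ltac:(lia)) as Hu2.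
  (* At a first return below [a], reached [S s] steps after time [S j], the points at times [S j]
     and [S (S j)], both in (a, c), would be separated by [g ^ s]. So the orbit never returns,
     against [HF]. *)
  assert (Hall : forall s, a < iter g (s + S j) x).
  { induction s as [|s IH]; [exact Hu1|].
    apply Rnot_le_lt. intros Hle.
    assert (Hlt : iter g (S s + S j) x < a).
    { destruct Hle as [|E]; [assumption|]. now destruct (nap_ne g x a _ Hn Hfix E). }
    apply (same_side_above g a c (iter g (S (S j)) x) (iter g (S j) x) s Hg Hfix);
      try apply Hfc; rewrite <- ?iter_plus; try lra.
    now replace (s + S (S j))%nat with (S s + S j)%nat by lia. }
  destruct (HF (S j)) as [k [Hk [Hka _]]].
  specialize (Hall (k - S j)%nat). replace (k - S j + S j)%nat with k in Hall by lia. lra.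
Qed.

(** * Points moving up and points moving down *)

Lemma lub_ge_fixed g (S : R -> Prop) q : continuity g -> is_lub S q ->
  (forall t, S t -> t <= g t) -> q <= g q.
Proof.
  intros Hc [Hub Hl] HS. apply Rnot_lt_le. intros Hlt.
  destruct (continuity_eps g q ((q - g q) / 2) Hc) as [d [Hd Hcd]]; [lra|].
  assert (q <= q - Rmin d ((q - g q) / 2)).
  { apply Hl. intros t Ht. apply Rnot_lt_le. intros Htq.
    pose proof (Hub t Ht). pose proof (Rmin_l d ((q - g q) / 2)).
    pose proof (Rmin_r d ((q - g q) / 2)).
    assert (Hk : Rabs (t - q) < d) by (apply Rabs_def1; lra).
    apply Hcd, Rabs_def2 in Hk. pose proof (HS t Ht). lra. }
  assert (0 < Rmin d ((q - g q) / 2)) by (apply Rmin_glb_lt; lra). lra.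
Qed.

Lemma last_fixed_point g u v : continuity g -> u < v -> g u < u -> v < g v ->
  exists c, u <= c < v /\ g c = c /\ forall t, c < t <= v -> t < g t.
Proof.
  intros Hc Huv Hu Hv.
  destruct (completeness (fun t => u <= t <= v /\ g t <= t)) as [c Hlub].
  - exists v. intros t Ht. lra.
  - exists u. lra.
  - assert (Huc : u <= c) by (apply Hlub; lra).
    assert (Hcv : c <= v) by (apply Hlub; intros t Ht; lra).
    assert (Hright : forall t, c < t <= v -> t < g t).
    { intros t Ht. apply Rnot_le_lt. intros H. assert (t <= c); [|lra].
      apply Hlub. lra. }
    assert (Hle : g c <= c).
    { assert (Hle : c <= 2 * c - g c); [|lra].
      (* Replacing [g t] by [2 * t - g t] reverses the inequality between [t] and its image. *)
      apply (lub_ge_fixed (fun t => 2 * t - g t) _ c) with (2 := Hlub).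
      - intros t. apply continuity_pt_minus; [|apply Hc].
        apply continuity_pt_scal, derivable_continuous_pt, derivable_pt_id.
      - intros t Ht. lra. }
    assert (Hne : c <> v) by (intros ->; lra).
    assert (Hge : c <= g c).
    { apply Rnot_lt_le. intros Hlt.
      destruct (continuity_eps g c (c - g c) Hc) as [d [Hd Hcd]]; [lra|].
      set (t := c + Rmin (d / 2) (v - c)).
      assert (0 < Rmin (d / 2) (v - c)) by (apply Rmin_glb_lt; lra).
      pose proof (Rmin_l (d / 2) (v - c)). pose proof (Rmin_r (d / 2) (v - c)).
      assert (Hk : Rabs (t - c) < d) by (unfold t; apply Rabs_def1; lra).
      apply Hcd, Rabs_def2 in Hk. assert (t < g t) by (apply Hright; unfold t; lra).
      unfold t in *. lra. }
    exists c. repeat split; [exact Huc|lra|lra|exact Hright].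
Qed.

(** Each [c, z] with [z <= v] is covered by its own image, as [c] is fixed and [z] does not move
    down; so [v] can be pulled back any number of times inside [c, v]. *)
Lemma iterated_preimage g c v n : continuity g -> c <= v -> g c = c ->
  (forall t, c < t <= v -> t < g t) -> exists y, c <= y <= v /\ iter g n y = v.
Proof.
  intros Hc Hcv Hfix Hup.
  assert (H : forall z, c <= z <= v -> exists y, c <= y <= v /\ iter g n y = z).
  { induction n as [|n IH]; intros z Hz.
    - exists z. split; [exact Hz|reflexivity].
    - destruct (ivt g c z z Hc) as [w [Hw Hwz]].
      + lra.
      + destruct (Req_dec c z) as [<-|]; [lra|]. apply Rlt_le, Hup. lra.
      + rewrite Rmin_left, Rmax_right in Hw by lra.
        destruct (IH w) as [y [Hy Hyw]]; [lra|]. exists y. split; [exact Hy|].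
        change (g (iter g n y) = z). now rewrite Hyw. }
  apply H. lra.
Qed.

(** Let [c] be the last fixed point before [v]. Some point of [c, v] is at [v] after [t] steps,
    while [v] itself has fallen to [u] or lower; so [c, v] stretches over [u, v]. By reflection, [s]
    steps do the same to the interval from [u] to the first fixed point after it, which is at most
    [c]. *)
Lemma no_crossing g u v s t : good g -> u < v -> g u < u -> v < g v ->
  v <= iter g s u -> iter g t v <= u -> False.
Proof.
  intros Hg Huv Hu Hv Hs Ht. pose proof (proj1 Hg) as Hc.
  destruct (last_fixed_point g u v Hc Huv Hu Hv) as [c [Hcv [Hcfix Hcup]]].
  destruct (iterated_preimage g c v t Hc) as [q2 [Hq2 Hq2v]]; [lra|assumption..|].
  pose proof (good_mirror g Hg) as Hg'.
  destruct (last_fixed_point (mirror g) (- v) (- u) (proj1 Hg')) as [c' [Hc'v [Hc'fix Hc'up]]];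
    [lra|unfold mirror; rewrite Ropp_involutive; lra|unfold mirror; rewrite Ropp_involutive; lra|].
  destruct (iterated_preimage (mirror g) c' (- u) s (proj1 Hg')) as [p [Hp Hpu]];
    [lra|assumption..|].
  rewrite iter_mirror in Hpu.
  assert (Hcc : - c' <= c).
  { apply Rnot_lt_le. intros Hlt. assert (H : - c' < g (- c')) by (apply Hcup; lra).
    unfold mirror in Hc'fix. lra. }
  apply (proj2 Hg u v c s t (- p) u v q2); lra.
Qed.

Lemma nap_mirror g x : ~ asymp_periodic g x -> ~ asymp_periodic (mirror g) (- x).
Proof. intros Hn H. now apply Hn, ap_mirror. Qed.

Lemma liminf_limsup_ex g x : bdd g x -> ~ asymp_periodic g x -> exists a b, a < b /\
  is_liminf (fun k => iter g k x) a /\ is_liminf (fun k => iter (mirror g) k (- x)) (- b).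
Proof.
  intros Hb Hn. destruct (liminf_ex g x Hb) as [a Ha].
  destruct (liminf_ex (mirror g) (- x) (bdd_mirror g x Hb)) as [b' Hb'].
  rewrite <- (Ropp_involutive b') in Hb'. exists a, (- b').
  split; [now apply (liminf_lt_limsup g x)|]. now split.
Qed.

Lemma up_down g x : good g -> bdd g x -> ~ asymp_periodic g x ->
  exists q, g q = q /\
    evt (fun k => (iter g k x < q /\ iter g k x < iter g (S k) x) \/
                  (q < iter g k x /\ iter g (S k) x < iter g k x)).
Proof.
  intros Hg Hb Hn. pose proof (proj1 Hg) as Hc.
  destruct (liminf_limsup_ex g x Hb Hn) as [a [b [Hab [Ha Hb']]]].
  pose proof (evt_not_two_below_liminf g x a Hg Hb Hn Ha) as G1.
  pose proof (evt_not_two_below_liminf (mirror g) (- x) (- b) (good_mirror g Hg)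
    (bdd_mirror g x Hb) (nap_mirror g x Hn) Hb') as G2.
  destruct (evt_and _ _ G1 G2) as [N HN]. clear G1 G2.
  apply is_liminf_mirror in Hb'. destruct Ha as [_ Ha], Hb' as [_ Hb'].
  (* An up-moving point lies below the limsup [b] and a down-moving one above the liminf [a], or two
     consecutive points would contradict [HN]. If the former were not below the latter, their orbits
     would later pass beyond each other. *)
  assert (Hsep : forall k l, (N <= k)%nat -> (N <= l)%nat ->
    iter g k x < iter g (S k) x -> iter g (S l) x < iter g l x -> iter g k x < iter g l x).
  { intros k l Hk Hl HU HD. apply Rnot_le_lt. intros Hle.
    assert (Hne : iter g l x <> iter g k x).
    { intros E. change (iter g k x < g (iter g k x)) in HU.
      change (g (iter g l x) < iter g l x) in HD. rewrite E in HD. lra. }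
    assert (Hal : a < iter g l x).
    { apply Rnot_le_lt. intros H. apply (proj1 (HN l Hl)). lra. }
    assert (Hkb : iter g k x < b).
    { apply Rnot_le_lt. intros H. apply (proj2 (HN k Hk)). rewrite !iter_mirror_opp. lra. }
    destruct (Hb' (b - iter g k x) ltac:(lra) l) as [i [Hi Hi']].
    destruct (Ha (iter g l x - a) ltac:(lra) k) as [j [Hj Hj']].
    apply (no_crossing g (iter g l x) (iter g k x) (i - l) (j - k) Hg);
      [lra|exact HD|exact HU|rewrite <- iter_plus..].
    - replace (i - l + l)%nat with i by lia. lra.
    - replace (j - k + k)%nat with j by lia. lra. }
  assert (HexU : exists k, (N <= k)%nat /\ iter g k x < iter g (S k) x).
  { apply NNPP. intros H. apply (nap_mirror g x Hn).
    apply (cv_monotone_ap (mirror g) (- x) 1 N (proj1 (good_mirror g Hg))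
      (bdd_mirror g x Hb) (le_n 1)).
    intros j. rewrite !iter_mirror_opp.
    replace (N + 1 * S j)%nat with (S (N + 1 * j)) by lia.
    apply Ropp_le_contravar, Rnot_lt_le. intros Hlt. apply H.
    exists (N + 1 * j)%nat. split; [lia|exact Hlt]. }
  assert (HexD : exists k, (N <= k)%nat /\ iter g (S k) x < iter g k x).
  { apply NNPP. intros H. apply Hn. apply (cv_monotone_ap g x 1 N Hc Hb (le_n 1)).
    intros j. replace (N + 1 * S j)%nat with (S (N + 1 * j)) by lia.
    apply Rnot_lt_le. intros Hlt. apply H.
    exists (N + 1 * j)%nat. split; [lia|exact Hlt]. }
  destruct HexU as [k0 [Hk0 HU0]]. destruct HexD as [l0 [Hl0 HD0]].
  set (D l := (N <= l)%nat /\ iter g (S l) x < iter g l x) in *.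
  (* The condition [t <= g t] passes to the supremum, so [q <= g q]. A strict inequality would
     persist just to the right of [q]; no late orbit point there would move down, and [T] would
     reach beyond [q]. *)
  set (T := fun t => t <= g t /\ forall l, D l -> t <= iter g l x).
  assert (HTU : forall k, (N <= k)%nat -> iter g k x < iter g (S k) x -> T (iter g k x)).
  { intros k Hk HU. split; [now apply Rlt_le|].
    intros l [Hl HD]. apply Rlt_le, Hsep; assumption. }
  destruct (completeness T) as [q Hq].
  - exists (iter g l0 x). intros t [_ Ht]. apply Ht. now split.
  - exists (iter g k0 x). now apply HTU.
  - assert (HqD : forall l, D l -> q <= iter g l x)
      by (intros l Hl; apply Hq; intros t [_ Ht]; now apply Ht).
    assert (Hqg : q <= g q) by (apply (lub_ge_fixed g T q Hc Hq); now intros t [Ht _]).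
    assert (Hfix : g q = q).
    { destruct Hqg as [Hlt|]; [exfalso|lra].
      destruct (continuity_eps g q ((g q - q) / 2) Hc) as [d [Hd Hcd]]; [lra|].
      set (d' := Rmin d ((g q - q) / 2)).
      assert (Hd' : 0 < d') by (apply Rmin_glb_lt; lra).
      pose proof (Rmin_l d ((g q - q) / 2) : d' <= _).
      pose proof (Rmin_r d ((g q - q) / 2) : d' <= _).
      assert (Hup : forall t, q <= t < q + d' -> t < g t).
      { intros t Ht. assert (Hk : Rabs (t - q) < d) by (apply Rabs_def1; lra).
        apply Hcd, Rabs_def2 in Hk. lra. }
      assert (q + d' / 2 <= q); [|lra].
      apply Hq. split; [apply Rlt_le, Hup; lra|].
      intros l Hl. apply Rnot_lt_le. intros Hl'. pose proof (HqD l Hl).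
      assert (Hlg : iter g l x < g (iter g l x)) by (apply Hup; lra).
      destruct Hl as [_ Hl]. change (g (iter g l x) < iter g l x) in Hl. lra. }
    exists q. split; [exact Hfix|]. exists N. intros k Hk.
    pose proof (nap_ne g x q k Hn Hfix) as Hne.
    destruct (Rtotal_order (iter g k x) (iter g (S k) x)) as [HU|[HE|HD]].
    + left. split; [|exact HU].
      destruct (proj1 Hq _ (HTU k Hk HU)); [assumption|contradiction].
    + destruct (nap_ne g x (iter g k x) k Hn); [|reflexivity].
      symmetry. exact HE.
    + right. split; [|exact HD]. specialize (HqD k (conj Hk HD)). lra.
Qed.

(* If it fails, two late pairs of consecutive points below [q] start at or below the
   liminf [a]; by [same_side_below] the itinerary with respect to [q] is eventually
   periodic, which makes the subsequence of their starting points increasing. *)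
Lemma evt_not_two_left g x q : good g -> bdd g x -> ~ asymp_periodic g x -> g q = q ->
  evt (fun k => (iter g k x < q /\ iter g k x < iter g (S k) x) \/
                (q < iter g k x /\ iter g (S k) x < iter g k x)) ->
  evt (fun k => ~ (iter g k x < q /\ iter g (S k) x < q)).
Proof.
  intros Hg Hb Hn Hq [N HN]. apply not_freq. intros HF.
  assert (Hret : forall k, (N <= k)%nat -> iter g k x < q -> iter g (S k) x < q ->
    forall n, iter g k x < iter g (S n + k) x).
  { intros k Hk H1 H2.
    assert (Hup : iter g k x < iter g (S k) x) by (destruct (HN k Hk); lra).
    induction n as [|n IH]; [exact Hup|].
    apply Rnot_le_lt. intros Hle.
    assert (Hqn : q < iter g (S n + k) x).
    { destruct (HN (S n + k)%nat) as [H|H]; [lia| |lra].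
      change (S (S n + k)) with (S (S n) + k)%nat in H. lra. }
    assert (E1 : iter g (S n) (iter g (S k) x) = iter g (S (S n) + k) x).
    { rewrite <- iter_plus. f_equal. lia. }
    assert (E2 : iter g (S n) (iter g k x) = iter g (S n + k) x) by now rewrite <- iter_plus.
    pose proof (iter_fixed g q (S n) Hq) as E3.
    (* Write u, v for the positions at times [k] and [S k]. In [S n] steps u goes above [q], v goes
       to u or lower, and [q] is fixed, so [u, v] and [v, q] both stretch over [u, q]. *)
    apply (proj2 Hg (iter g k x) q (iter g (S k) x) (S n) (S n)
      (iter g (S k) x) (iter g k x) (iter g (S k) x) q); lra. }
  destruct (liminf_ex g x Hb) as [a Ha].
  destruct (evt_not_two_below_liminf g x a Hg Hb Hn Ha) as [N1 HN1].
  destruct Ha as [_ Ha].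
  assert (Hlow : forall k, (N <= k)%nat -> iter g k x < q -> iter g (S k) x < q ->
    iter g k x <= a).
  { intros k Hk H1 H2. apply Rnot_lt_le. intros Hlt.
    destruct (Ha (iter g k x - a) ltac:(lra) (S k)) as [j [Hj Hj']].
    specialize (Hret k Hk H1 H2 (j - S k)%nat).
    replace (S (j - S k) + k)%nat with j in Hret by lia. lra. }
  destruct (HF (Nat.max N N1)) as [k [Hk [Hk1 Hk2]]].
  destruct (HF (S k)) as [k' [Hk' [Hk1' Hk2']]].
  pose proof (Hlow k ltac:(lia) Hk1 Hk2) as Hka.
  pose proof (Hlow k' ltac:(lia) Hk1' Hk2') as Hka'.
  assert (Hka1 : a < iter g (S k) x)
    by (apply Rnot_le_lt; intros H; apply (HN1 k ltac:(lia)); now split).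
  assert (Hka1' : a < iter g (S k') x)
    by (apply Rnot_le_lt; intros H; apply (HN1 k' ltac:(lia)); now split).
  set (e := Rmin (iter g (S k) x) (iter g (S k') x)).
  assert (Hea : a < e) by (apply Rmin_glb_lt; assumption).
  assert (He1 : e <= iter g (S k) x) by apply Rmin_l.
  assert (He2 : e <= iter g (S k') x) by apply Rmin_r.
  assert (Hfe : forall n, freq (fun i => iter g i (iter g n x) <= e)).
  { intros n. eapply freq_impl; [|exact (freq_shift _ n (Ha (e - a) ltac:(lra)))].
    intros i Hi. cbv beta in *. rewrite <- iter_plus. lra. }
  assert (Hside : forall s, iter g (s + S k) x < q -> iter g (s + S k') x < q).
  { intros s Hs. apply Rnot_le_lt. intros Hle.
    pose proof (nap_ne g x q (s + S k') Hn Hq).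
    apply (same_side_below g q e (iter g (S k) x) (iter g (S k') x) s Hg Hq);
      try apply Hfe; rewrite <- ?iter_plus; lra. }
  set (t := (k' - k)%nat).
  assert (Hper : forall j, iter g (k' + t * j) x < q /\ iter g (S (k' + t * j)) x < q).
  { induction j as [|j [IH1 IH2]].
    - rewrite Nat.mul_0_r, Nat.add_0_r. now split.
    - replace (k' + t * S j)%nat with (k' + t * j - S k + S k')%nat by (unfold t; nia).
      replace (S (k' + t * j - S k + S k')) with (S (k' + t * j) - S k + S k')%nat by lia.
      split; apply Hside.
      + now replace (k' + t * j - S k + S k)%nat with (k' + t * j)%nat by lia.
      + now replace (S (k' + t * j) - S k + S k)%nat with (S (k' + t * j)) by lia. }
  apply Hn. apply (cv_monotone_ap g x t k' (proj1 Hg) Hb); [unfold t; lia|].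
  intros j. destruct (Hper j) as [H1 H2].
  pose proof (Hret (k' + t * j)%nat ltac:(lia) H1 H2 (t - 1)%nat) as H.
  replace (S (t - 1) + (k' + t * j))%nat with (k' + t * S j)%nat in H by (unfold t; nia).
  now apply Rlt_le.
Qed.

Definition alternates g x q :=
  evt (fun k => (iter g k x < q /\ q < iter g (S k) x) \/
                (q < iter g k x /\ iter g (S k) x < q)).

Lemma alternates_ex g x : good g -> bdd g x -> ~ asymp_periodic g x ->
  exists q, g q = q /\ alternates g x q.
Proof.
  intros Hg Hb Hn. destruct (up_down g x Hg Hb Hn) as [q [Hq HUD]].
  exists q. split; [exact Hq|].
  pose proof (evt_not_two_left g x q Hg Hb Hn Hq HUD) as H1.
  assert (H2 : evt (fun k => ~ (q < iter g k x /\ q < iter g (S k) x))).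
  { pose proof (evt_not_two_left (mirror g) (- x) (- q) (good_mirror g Hg) (bdd_mirror g x Hb)
      (nap_mirror g x Hn) (mirror_fixed g q Hq)) as H2.
    eapply evt_impl; [|apply H2].
    - intros k Hk. cbv beta in Hk. rewrite !iter_mirror_opp in Hk.
      intros [H3 H4]. apply Hk. lra.
    - eapply evt_impl; [|exact HUD]. intros k Hk. cbv beta in *.
      rewrite !iter_mirror_opp. lra. }
  eapply evt_impl; [|exact (evt_and _ _ H1 H2)].
  intros k [H3 H4]. pose proof (nap_ne g x q k Hn Hq) as Hne1.
  pose proof (nap_ne g x q (S k) Hn Hq) as Hne2.
  destruct (Rlt_le_dec (iter g k x) q); destruct (Rlt_le_dec (iter g (S k) x) q); lra.
Qed.

Definition clusters (u : nat -> R) c := forall eps, 0 < eps -> freq (fun k => Rabs (u k - c) < eps).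

(** An orbit point close to a fixed point [c] has its successor close to [c] too; if [c] differed
    from [q], both would be on the same side of [q]. *)
Lemma alternates_cluster g x q c : continuity g -> alternates g x q -> g c = c ->
  clusters (fun k => iter g k x) c -> c = q.
Proof.
  intros Hg HA Hc Hcl. apply NNPP. intros Hne.
  assert (He : 0 < Rabs (c - q)) by (apply Rabs_pos_lt; lra).
  destruct (continuity_eps g c (Rabs (c - q)) Hg He) as [d [Hd Hcd]].
  destruct (freq_evt _ _ (Hcl (Rmin d (Rabs (c - q))) (Rmin_glb_lt _ _ _ Hd He)) HA 0%nat)
    as [k [_ [Hk HA']]].
  assert (H1 : Rabs (iter g k x - c) < Rabs (c - q)) by
    (eapply Rlt_le_trans; [exact Hk|apply Rmin_r]).
  assert (H2 : Rabs (iter g (S k) x - c) < Rabs (c - q)).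
  { rewrite <- Hc at 1. apply Hcd. eapply Rlt_le_trans; [exact Hk|apply Rmin_l]. }
  clear - H1 H2 HA'. revert H1 H2. unfold Rabs.
  repeat destruct Rcase_abs; lra.
Qed.

Lemma nap_shift g x n : continuity g -> ~ asymp_periodic g x -> ~ asymp_periodic g (iter g n x).
Proof. intros Hg Hn H. now apply Hn, (ap_unshift g x n Hg). Qed.

(* [q] is the only fixed point that could be in the omega-limit set. The square of
   [g] would then alternate about [q] as well, yet its orbits stay on one side of [q]. *)
Lemma fixed_not_cluster g x c : good g -> bdd g x -> ~ asymp_periodic g x -> g c = c ->
  ~ clusters (fun k => iter g k x) c.
Proof.
  intros Hg Hb Hn Hc Hcl. pose proof (proj1 Hg) as Hcont.
  destruct (alternates_ex g x Hg Hb Hn) as [q [Hq HA]].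
  pose proof (alternates_cluster g x q c Hcont HA Hc Hcl) as ->.
  destruct HA as [N HN]. set (y := iter g N x).
  pose proof (good_iter g 2 Hg) as Hg2.
  assert (Hn2 : ~ asymp_periodic (iter g 2) y).
  { intros H. apply (nap_shift g x N Hcont Hn). apply (ap_iter g y 2) in H; [exact H|lia]. }
  destruct (alternates_ex (iter g 2) y Hg2 (bdd_iter _ _ _ (bdd_shift g x N Hb)) Hn2)
    as [q2 [Hq2 HA2]].
  assert (Hcl2 : clusters (fun k => iter (iter g 2) k y) q).
  { intros eps He M. destruct (continuity_eps g q eps Hcont He) as [d [Hd Hcd]].
    destruct (Hcl (Rmin d eps) (Rmin_glb_lt _ _ _ Hd He) (M * 2 + N)%nat) as [k [Hk Hkd]].
    assert (Hkd' : Rabs (iter g (S k) x - q) < eps).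
    { rewrite <- Hq at 1. apply Hcd. eapply Rlt_le_trans; [exact Hkd|apply Rmin_l]. }
    assert (Hkd2 : Rabs (iter g k x - q) < eps) by
      (eapply Rlt_le_trans; [exact Hkd|apply Rmin_r]).
    pose proof (Nat.div_mod_eq (k - N) 2) as Hdm.
    pose proof (Nat.mod_upper_bound (k - N) 2 ltac:(lia)) as Hmod.
    destruct (Nat.eq_dec ((k - N) mod 2) 0) as [E|E].
    - exists ((k - N) / 2)%nat. split; [lia|]. unfold y. rewrite iter_mult, <- iter_plus.
      now replace ((k - N) / 2 * 2 + N)%nat with k by lia.
    - exists (S ((k - N) / 2))%nat. split; [lia|]. unfold y. rewrite iter_mult, <- iter_plus.
      now replace (S ((k - N) / 2) * 2 + N)%nat with (S k) by lia. }
  pose proof (alternates_cluster _ _ _ _ (proj1 Hg2) HA2 (iter_fixed g q 2 Hq) Hcl2) as <-.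
  destruct HA2 as [M HM]. specialize (HM M (le_n M)). unfold y in HM.
  rewrite !iter_mult, <- !iter_plus in HM.
  replace (S M * 2 + N)%nat with (S (S (M * 2 + N))) in HM by lia.
  pose proof (HN (M * 2 + N)%nat ltac:(lia)). pose proof (HN (S (M * 2 + N))%nat ltac:(lia)).
  lra.
Qed.

Lemma fixed_evt_away g x c : good g -> bdd g x -> ~ asymp_periodic g x -> g c = c ->
  exists eps, 0 < eps /\ evt (fun k => eps <= Rabs (iter g k x - c)).
Proof.
  intros Hg Hb Hn Hc. apply NNPP. intros H.
  apply (fixed_not_cluster g x c Hg Hb Hn Hc). intros eps He. apply NNPP. intros HF.
  apply H. exists eps. split; [exact He|].
  eapply evt_impl; [|exact (not_freq _ HF)]. intros k Hk. now apply Rnot_lt_le.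
Qed.

(** * Proximal orbits *)

Definition proximal g x y :=
  forall eps, 0 < eps -> freq (fun k => Rabs (iter g k x - iter g k y) < eps).

Lemma proximal_sym g x y : proximal g x y -> proximal g y x.
Proof.
  intros H eps He. eapply freq_impl; [|exact (H eps He)].
  intros k Hk. cbv beta in *. now rewrite Rabs_minus_sym.
Qed.

(** Uniform continuity on a compact interval containing both orbits keeps them close for [n] further
    steps. *)
Lemma proximal_window g x y n : continuity g -> bdd g x -> bdd g y -> proximal g x y ->
  forall eps, 0 < eps ->
  freq (fun k => forall i, (i <= n)%nat -> Rabs (iter g (i + k) x - iter g (i + k) y) < eps).
Proof.
  intros Hc [M HM] [M' HM'] Hp.
  assert (HI : forall k, - Rmax M M' <= iter g k x <= Rmax M M' /\
                         - Rmax M M' <= iter g k y <= Rmax M M').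
  { intros k. pose proof (HM k) as H1. pose proof (HM' k) as H2.
    pose proof (Rmax_l M M'). pose proof (Rmax_r M M').
    pose proof (Rle_abs (iter g k x)). pose proof (Rle_abs (- iter g k x)) as Hx.
    pose proof (Rle_abs (iter g k y)). pose proof (Rle_abs (- iter g k y)) as Hy.
    rewrite Rabs_Ropp in Hx, Hy. lra. }
  induction n as [|n IH]; intros eps He.
  - eapply freq_impl; [|exact (Hp eps He)]. intros k Hk i Hi.
    replace i with 0%nat by lia. exact Hk.
  - destruct (Heine g _ (compact_P3 (- Rmax M M') (Rmax M M'))
      (fun x _ => Hc x) (mkposreal eps He)) as [d Hd]. simpl in Hd.
    eapply freq_impl; [|exact (IH (Rmin d eps) (Rmin_glb_lt _ _ _ (cond_pos d) He))].
    intros k Hk i Hi.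
    destruct (Nat.eq_dec i (S n)) as [->|].
    + apply Hd; [apply HI..|]. eapply Rlt_le_trans; [apply (Hk n (le_n n))|apply Rmin_l].
    + eapply Rlt_le_trans; [apply Hk; lia|apply Rmin_r].
Qed.

Lemma proximal_iter_shift g x y p r : continuity g -> bdd g x -> bdd g y -> (1 <= p)%nat ->
  proximal g x y -> proximal (iter g p) (iter g r x) (iter g r y).
Proof.
  intros Hc Hbx Hby Hpos Hp eps He N.
  destruct (proximal_window g x y p Hc Hbx Hby Hp eps He (r + p * N)%nat) as [k [Hk Hki]].
  pose proof (Nat.div_mod_eq (k - r) p) as Hdm.
  pose proof (Nat.mod_upper_bound (k - r) p ltac:(lia)) as Hmod.
  exists (S ((k - r) / p)). split; [nia|].
  rewrite !iter_mult, <- !iter_plus.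
  replace (S ((k - r) / p) * p + r)%nat with ((p - (k - r) mod p) + k)%nat by nia.
  apply Hki. lia.
Qed.

Lemma alternates_mirror g x q : alternates g x q -> alternates (mirror g) (- x) (- q).
Proof.
  intros H. eapply evt_impl; [|exact H]. intros k Hk. cbv beta in *.
  rewrite !iter_mirror_opp. lra.
Qed.

Lemma proximal_mirror g x y : proximal g x y -> proximal (mirror g) (- x) (- y).
Proof.
  intros H eps He. eapply freq_impl; [|exact (H eps He)]. intros k Hk. cbv beta in *.
  rewrite !iter_mirror_opp. replace (- iter g k x - - iter g k y)
    with (- (iter g k x - iter g k y)) by ring. now rewrite Rabs_Ropp.
Qed.

(** The two orbits might alternate about different fixed points. Close approaches put them in phase,
    and a horseshoe on [q, q'] keeps [y] out of the gap, so that [q] serves for [y] as well. *)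
Lemma proximal_same_side_aux g x y q q' : good g -> bdd g x -> bdd g y ->
  ~ asymp_periodic g x -> ~ asymp_periodic g y -> proximal g x y ->
  g q = q -> alternates g x q -> g q' = q' -> alternates g y q' -> q <= q' ->
  evt (fun k => (iter g k x < q /\ iter g k y < q) \/ (q < iter g k x /\ q < iter g k y)).
Proof.
  intros Hg Hbx Hby Hnx Hny Hp Hq HA Hq' HA' Hqq.
  destruct (fixed_evt_away g x q Hg Hbx Hnx Hq) as [eps [He Haway]].
  destruct (evt_and _ _ Haway (evt_and _ _ HA HA')) as [N HN]. clear Haway HA HA'.
  assert (Hwin := proximal_window g x y 1 (proj1 Hg) Hbx Hby Hp eps He).
  (* At two consecutive close times [x] is on different sides of [q], at distance at least [eps], so
     [y] is on the same sides. If [y] goes down, its alternation about [q'] shows that it started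
     above [q']. *)
  assert (Hphase : freq (fun k => (iter g k x < q /\ iter g k y < q) \/
     (q < iter g k x /\ q' < iter g k y /\ iter g (S k) y < q))).
  { intros K. destruct (Hwin (Nat.max N K)) as [k [Hk Hk2]]. exists k. split; [lia|].
    pose proof (Hk2 0%nat ltac:(lia)) as W0. pose proof (Hk2 1%nat ltac:(lia)) as W1.
    change (0 + k)%nat with k in W0. change (1 + k)%nat with (S k) in W1.
    apply Rabs_def2 in W0. apply Rabs_def2 in W1.
    destruct (HN k ltac:(lia)) as [H0 [H1 H2]]. destruct (HN (S k) ltac:(lia)) as [H3 _].
    revert H0 H3. unfold Rabs. do 2 destruct Rcase_abs; lra. }
  assert (Hlow : freq (fun k => iter g k y < q)).
  { intros K. destruct (Hphase K) as [k [Hk [H|H]]].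
    - exists k. split; [exact Hk|apply H].
    - exists (S k). split; [lia|apply H]. }
  assert (Hgap : forall k, (N <= k)%nat -> ~ (q < iter g k y < q')).
  { intros k Hk H. destruct (HN k Hk) as [_ [_ HAk]].
    destruct (Hlow k) as [l [Hl Hlq]].
    pose proof (iter_fixed g q' (l - k) Hq').
    assert (E : iter g (l - k) (iter g k y) = iter g l y)
      by (rewrite <- iter_plus; f_equal; lia).
    (* A point of the gap goes above [q'] in one step and below [q] later. Since [q] and [q'] are
       fixed, each part of [q, q'] cut at this point stretches over the whole. *)
    apply (proj2 Hg q q' (iter g k y) 1 (l - k) q (iter g k y) (iter g k y) q')%nat; try lra.
    - change (g q <= q). lra.
    - change (q' <= iter g (S k) y). lra. }
  destruct (Hphase N) as [k [Hk Hk2]].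
  assert (Hsync : forall n, (iter g (n + k) x < q /\ iter g (n + k) y < q') \/
                            (q < iter g (n + k) x /\ q' < iter g (n + k) y)).
  { induction n as [|n IH].
    - change (0 + k)%nat with k. lra.
    - destruct (HN (n + k)%nat ltac:(lia)) as [_ H]. change (S n + k)%nat with (S (n + k)). lra. }
  exists k. intros j Hj. specialize (Hsync (j - k)%nat).
  replace (j - k + k)%nat with j in Hsync by lia.
  pose proof (Hgap j ltac:(lia)). pose proof (nap_ne g y q j Hny Hq). lra.
Qed.

Lemma proximal_same_side g x y q : good g -> bdd g x -> bdd g y ->
  ~ asymp_periodic g x -> ~ asymp_periodic g y -> proximal g x y ->
  g q = q -> alternates g x q ->
  evt (fun k => (iter g k x < q /\ iter g k y < q) \/ (q < iter g k x /\ q < iter g k y)).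
Proof.
  intros Hg Hbx Hby Hnx Hny Hp Hq HA.
  destruct (alternates_ex g y Hg Hby Hny) as [q' [Hq' HA']].
  destruct (Rle_lt_dec q q') as [Hle|Hlt].
  - now apply (proximal_same_side_aux g x y q q').
  - eapply evt_impl; [|apply (proximal_same_side_aux (mirror g) (- x) (- y) (- q) (- q'))].
    + intros k Hk. cbv beta in Hk. rewrite !iter_mirror_opp in Hk. lra.
    + now apply good_mirror.
    + now apply bdd_mirror.
    + now apply bdd_mirror.
    + now apply nap_mirror.
    + now apply nap_mirror.
    + now apply proximal_mirror.
    + now apply mirror_fixed.
    + now apply alternates_mirror.
    + now apply mirror_fixed.
    + now apply alternates_mirror.
    + lra.
Qed.

(** * Three orbits in a common period doubling pattern *)

Definition below3 g x y z q n := iter g n x < q /\ iter g n y < q /\ iter g n z < q.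
Definition above3 g x y z q n := q < iter g n x /\ q < iter g n y /\ q < iter g n z.

(** One level of the period doubling pattern, with [q] meant to be fixed by [g ^ p]. It is demanded
    from time 0 rather than eventually, because it is applied to points already moved far along
    their orbits, so that time is counted from a chosen visit. *)
Definition splits g x y z p q :=
  (forall j, below3 g x y z q (2 * p * j) /\ above3 g x y z q (p + 2 * p * j)) \/
  (forall j, above3 g x y z q (2 * p * j) /\ below3 g x y z q (p + 2 * p * j)).

Lemma below3_shift g x y z q n r :
  below3 g (iter g r x) (iter g r y) (iter g r z) q n <-> below3 g x y z q (n + r).
Proof. unfold below3. now rewrite !iter_plus. Qed.

Lemma above3_shift g x y z q n r :
  above3 g (iter g r x) (iter g r y) (iter g r z) q n <-> above3 g x y z q (n + r).
Proof. unfold above3. now rewrite !iter_plus. Qed.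

Definition proximal_triple g x y z :=
  good g /\ (bdd g x /\ bdd g y /\ bdd g z) /\
  (~ asymp_periodic g x /\ ~ asymp_periodic g y /\ ~ asymp_periodic g z) /\
  proximal g x y /\ proximal g x z.

Lemma residue_alternates g x y z p r : proximal_triple g x y z -> (1 <= p)%nat ->
  exists q, iter g p q = q /\ evt (fun j =>
    (below3 g x y z q (p * j + r) /\ above3 g x y z q (p * S j + r)) \/
    (above3 g x y z q (p * j + r) /\ below3 g x y z q (p * S j + r))).
Proof.
  intros [Hg [[Bx [By Bz]] [[Nx [Ny Nz]] [Pxy Pxz]]]] Hpos.
  pose proof (proj1 Hg) as Hc. pose proof (good_iter g p Hg) as Hgp.
  assert (Hb : forall u, bdd g u -> bdd (iter g p) (iter g r u))
    by (intros; now apply bdd_iter, bdd_shift).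
  assert (Hn : forall u, ~ asymp_periodic g u -> ~ asymp_periodic (iter g p) (iter g r u)).
  { intros u Hu H. apply (nap_shift g u r Hc Hu). now apply (ap_iter g _ p Hpos). }
  assert (Hp : forall u, bdd g u -> proximal g x u ->
     proximal (iter g p) (iter g r x) (iter g r u))
    by (intros; now apply proximal_iter_shift).
  destruct (alternates_ex (iter g p) (iter g r x)) as [q [Hq HA]]; auto.
  exists q. split; [exact Hq|].
  destruct (proximal_same_side (iter g p) (iter g r x) (iter g r y) q) as [N1 H1]; auto.
  destruct (proximal_same_side (iter g p) (iter g r x) (iter g r z) q) as [N2 H2]; auto.
  destruct HA as [N HA]. exists (Nat.max N (Nat.max N1 N2)). intros j Hj.
  pose proof (HA j ltac:(lia)) as A0.
  pose proof (H1 j ltac:(lia)) as B0. pose proof (H1 (S j) ltac:(lia)) as B1.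
  pose proof (H2 j ltac:(lia)) as C0. pose proof (H2 (S j) ltac:(lia)) as C1.
  cbv beta in A0, B0, B1, C0, C1. rewrite !iter_mult, <- !iter_plus in A0, B0, B1, C0, C1.
  rewrite (Nat.mul_comm p j), (Nat.mul_comm p (S j)).
  unfold below3, above3. lra.
Qed.

(** Alternation under [g ^ p] holds in each residue class modulo [p] with its own [q] and its own
    threshold. There are only [p] classes, so a common threshold exists, and beyond it one position
    determines the sides at all later times of the class. *)
Lemma evt_splits g x y z p : proximal_triple g x y z -> (1 <= p)%nat ->
  evt (fun r => exists q, iter g p q = q /\
    splits g (iter g r x) (iter g r y) (iter g r z) p q).
Proof.
  intros HC Hpos.
  assert (Hfin : forall n, exists N, forall r, (r < n)%nat -> exists q, iter g p q = q /\
    forall j, (N <= j)%nat -> (below3 g x y z q (p * j + r) /\ above3 g x y z q (p * S j + r)) \/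
    (above3 g x y z q (p * j + r) /\ below3 g x y z q (p * S j + r))).
  { induction n as [|n [N IH]]; [exists 0%nat; intros; lia|].
    destruct (residue_alternates g x y z p n HC Hpos) as [q [Hq [N' HN']]].
    exists (Nat.max N N'). intros r Hr. destruct (Nat.eq_dec r n) as [->|Hne].
    - exists q. split; [exact Hq|]. intros j Hj. apply HN'. lia.
    - destruct (IH r ltac:(lia)) as [q' [Hfix Hq']]. exists q'. split; [exact Hfix|].
      intros j Hj. apply Hq'. lia. }
  destruct (Hfin p) as [N HN]. exists (p * S N)%nat. intros r Hr.
  pose proof (Nat.div_mod_eq r p) as Hdm.
  pose proof (Nat.mod_upper_bound r p ltac:(lia)) as Hmod.
  destruct (HN (r mod p) Hmod) as [q [Hfix Hq]]. exists q. split; [exact Hfix|].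
  set (k := (r / p)%nat) in *. assert (HNk : (N <= k)%nat) by nia.
  assert (Hexcl : forall n, below3 g x y z q n -> above3 g x y z q n -> False)
    by (unfold below3, above3; intros; lra).
  unfold splits. setoid_rewrite below3_shift. setoid_rewrite above3_shift.
  assert (E : forall i, (p * i + r = p * (i + k) + r mod p)%nat) by (intros; nia).
  assert (Hq' : forall i, (below3 g x y z q (p * i + r) /\ above3 g x y z q (p * S i + r)) \/
                          (above3 g x y z q (p * i + r) /\ below3 g x y z q (p * S i + r))).
  { intros i. rewrite !E. apply (Hq (i + k)%nat). lia. }
  assert (E1 : forall j, (2 * p * j = p * (2 * j))%nat) by (intros; nia).
  assert (E2 : forall j, (p + 2 * p * j = p * (S (2 * j)))%nat) by (intros; nia).
  assert (E3 : forall j, (2 * S j = S (S (2 * j)))%nat) by (intros; lia).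
  destruct (Hq' 0%nat) as [[H0 H1]|[H0 H1]]; [left|right]; intros j; rewrite E2, E1.
  - induction j as [|j [IH1 IH2]]; [now split|].
    rewrite E3. destruct (Hq' (S (2 * j))) as [[H2 H3]|[H2 H3]]; [now destruct (Hexcl _ H2 IH2)|].
    destruct (Hq' (S (S (2 * j)))) as [[H4 H5]|[H4 H5]]; [|now destruct (Hexcl _ H3 H4)].
    now split.
  - induction j as [|j [IH1 IH2]]; [now split|].
    rewrite E3. destruct (Hq' (S (2 * j))) as [[H2 H3]|[H2 H3]]; [|now destruct (Hexcl _ IH2 H2)].
    destruct (Hq' (S (S (2 * j)))) as [[H4 H5]|[H4 H5]]; [now destruct (Hexcl _ H4 H3)|].
    now split.
Qed.

(** * Visits in the wrong residue class *)

Lemma cluster_ge g u a c : continuity g -> clusters u a -> (forall j, c <= g (u j)) -> c <= g a.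
Proof.
  intros Hg Hu Hc. apply Rnot_lt_le. intros Hlt.
  destruct (continuity_eps g a (c - g a) Hg) as [d [Hd Hcd]]; [lra|].
  destruct (Hu d Hd 0%nat) as [k [_ Hk]]. apply Hcd, Rabs_def2 in Hk. specialize (Hc k). lra.
Qed.

Lemma cluster_le g u a c : continuity g -> clusters u a -> (forall j, g (u j) <= c) -> g a <= c.
Proof.
  intros Hg Hu Hc. apply Rnot_lt_le. intros Hlt.
  destruct (continuity_eps g a (g a - c) Hg) as [d [Hd Hcd]]; [lra|].
  destruct (Hu d Hd 0%nat) as [k [_ Hk]]. apply Hcd, Rabs_def2 in Hk. specialize (Hc k). lra.
Qed.

(* [X], [Y], [Z] are the positions of the three orbits at a late time [r], and [w] is the
   position of the second one at an earlier time [r - p (2 h + 1)], so that its residue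
   modulo [2 p] is wrong. Two stretched intervals meet at a point [y] of (a, w] whose image
   is [q], or the position of the first orbit at time [r + 2 p], according to whether that
   position is below or above the position at time [r]. *)
Lemma no_late_visit_left g X Y Z p h w a d q q2 : good g -> (1 <= p)%nat ->
  iter g (p * (2 * h + 1)) w = Y -> iter g p q = q ->
  (forall j, below3 g X Y Z q (2 * p * j) /\ above3 g X Y Z q (p + 2 * p * j)) ->
  clusters (fun j => iter g (4 * p * j) X) a -> clusters (fun j => iter g (4 * p * j) Z) d ->
  a < w < d -> splits g X Y Z (2 * p) q2 -> False.
Proof.
  intros [Hc Hh] Hp Hw Hq Hs Ha Hd Haw Hs2.
  set (i := (p * (2 * h + 1))%nat) in *.
  assert (Hci : forall n, continuity (iter g n)) by (intros; now apply iter_continuity).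
  assert (Hqlow : forall j, below3 g X Y Z q (2 * p * j)) by apply Hs.
  assert (Hqup : forall j, above3 g X Y Z q (p + 2 * p * j)) by apply Hs.
  (* [i + 2 * p * n] is an odd multiple of [p], so it leads the orbits from even multiples of [p] to
     above [q]; as a weak inequality this passes to the limits [a] and [d]. *)
  assert (HX : forall n j, q <= iter g (i + 2 * p * n) (iter g (4 * p * j) X)).
  { intros n j. rewrite <- iter_plus. apply Rlt_le.
    replace (i + 2 * p * n + 4 * p * j)%nat with (p + 2 * p * (h + n + 2 * j))%nat
      by (unfold i; ring). apply Hqup. }
  assert (HZ : forall n j, q <= iter g (i + 2 * p * n) (iter g (4 * p * j) Z)).
  { intros n j. rewrite <- iter_plus. apply Rlt_le.
    replace (i + 2 * p * n + 4 * p * j)%nat with (p + 2 * p * (h + n + 2 * j))%nat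
      by (unfold i; ring). apply Hqup. }
  assert (Hia : forall n, q <= iter g (i + 2 * p * n) a)
    by (intros n; apply (cluster_ge _ _ a q (Hci _) Ha), HX).
  assert (Hid : forall n, q <= iter g (i + 2 * p * n) d)
    by (intros n; apply (cluster_ge _ _ d q (Hci _) Hd), HZ).
  assert (Hdq : d <= q).
  { apply (cluster_le (iter g 0) _ d q (Hci _) Hd). intros j. apply Rlt_le.
    change (iter g (4 * p * j) Z < q).
    replace (4 * p * j)%nat with (2 * p * (2 * j))%nat by ring. apply Hqlow. }
  assert (Hi0 : q <= iter g i a)
    by (specialize (Hia 0%nat); now rewrite Nat.mul_0_r, Nat.add_0_r in Hia).
  assert (E4 : forall j, (4 * p * j = 2 * (2 * p) * j)%nat) by (intros; ring).
  destruct Hs2 as [Hs2|Hs2].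
  - assert (H2 : iter g (2 * p) X < q).
    { rewrite <- (Nat.mul_1_r (2 * p)). apply Hqlow. }
    destruct (ivt (iter g i) w a (iter g (2 * p) X) (Hci _)) as [y [Hy Hyi]].
    { rewrite Hw. destruct (Hs2 0%nat) as [[_ [H _]] [H' _]].
      rewrite Nat.mul_0_r in H. rewrite Nat.mul_0_r, Nat.add_0_r in H'.
      change (Y < q2) in H. lra. }
    { lra. }
    rewrite Rmin_right, Rmax_left in Hy by lra.
    assert (Hya : a < y).
    { destruct (proj1 Hy) as [|E]; [assumption|]. rewrite <- E in Hyi. lra. }
    (* Either [a] itself serves as left end, or the orbit of [X] stays above [a] at late multiples
       of [4 * p] and one of its points close to [a] serves. In both cases this orbit keeps coming
       back to [a'] or lower. *)
    assert (Ha' : exists a', a <= a' < y /\ (forall n, q <= iter g (i + 2 * p * n) a') /\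
               freq (fun j => iter g (4 * p * j) X <= a')).
    { destruct (classic (freq (fun j => iter g (4 * p * j) X <= a))) as [HF|HF].
      - exists a. split; [lra|]. now split.
      - destruct (not_freq _ HF) as [N HN].
        destruct (Ha (y - a) ltac:(lra) N) as [j [Hj Hja]]. cbv beta in Hja.
        pose proof (HN j Hj) as Haj. apply Rabs_def2 in Hja.
        exists (iter g (4 * p * j) X). split; [lra|]. split; [intros n; apply HX|].
        eapply freq_impl; [|exact (Ha (iter g (4 * p * j) X - a) ltac:(lra))].
        intros l Hl. cbv beta in Hl. apply Rabs_def2 in Hl. lra. }
    destruct Ha' as [a' [Haa' [Hup HF]]].
    destruct (HF 1%nat) as [j [Hj Hja]].
    (* After [i] steps [y] is where [X] is at time [2 * p]; another [2 * p * m] steps lead to time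
       [4 * p * j], where [X] is at most [a']. *)
    set (m := (2 * j - 1)%nat).
    assert (E : iter g (i + 2 * p * m) y = iter g (4 * p * j) X).
    { rewrite Nat.add_comm, iter_plus, Hyi, <- iter_plus. f_equal. unfold m. nia. }
    pose proof (Hup m). pose proof (Hid m).
    apply (Hh a' q y (i + 2 * p * m) (i + 2 * p * m) y a' y d)%nat; lra.
  - assert (Hq2a : q2 <= a).
    { apply (cluster_ge (iter g 0) _ a q2 (Hci _) Ha). intros j. apply Rlt_le.
      change (q2 < iter g (4 * p * j) X). rewrite E4. apply Hs2. }
    destruct (ivt (iter g i) w a q (Hci _)) as [y [Hy Hyi]].
    { rewrite Hw. apply Rlt_le. destruct (Hqlow 0%nat) as [_ [H _]].
      rewrite Nat.mul_0_r in H. exact H. }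
    { exact Hi0. }
    rewrite Rmin_right, Rmax_left in Hy by lra.
    (* [t] is [2 * p] modulo [4 * p], which sends [a] and [d] to [q2] or lower, and it exceeds [i]
       by a multiple of [p], which leaves the image of [y] at [q]. *)
    set (t := (4 * p * (h + 1) + 2 * p)%nat).
    assert (Hty : iter g t y = q).
    { replace t with ((2 * h + 5) * p + i)%nat by (unfold t, i; ring).
      rewrite iter_plus, Hyi, <- iter_mult. now apply iter_fixed. }
    assert (Hta : iter g t a <= q2).
    { apply (cluster_le _ _ a q2 (Hci _) Ha). intros j. rewrite <- iter_plus. apply Rlt_le.
      replace (t + 4 * p * j)%nat with (2 * p + 2 * (2 * p) * (h + 1 + j))%nat
        by (unfold t; ring). apply Hs2. }
    assert (Htd : iter g t d <= q2).
    { apply (cluster_le _ _ d q2 (Hci _) Hd). intros j. rewrite <- iter_plus. apply Rlt_le.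
      replace (t + 4 * p * j)%nat with (2 * p + 2 * (2 * p) * (h + 1 + j))%nat
        by (unfold t; ring). apply Hs2. }
    apply (Hh q2 q y t t a y d y); lra.
Qed.

Lemma below3_mirror g x y z q n : below3 (mirror g) (- z) (- y) (- x) (- q) n <-> above3 g x y z q n.
Proof. unfold below3, above3. rewrite !iter_mirror_opp. lra. Qed.

Lemma above3_mirror g x y z q n : above3 (mirror g) (- z) (- y) (- x) (- q) n <-> below3 g x y z q n.
Proof. unfold below3, above3. rewrite !iter_mirror_opp. lra. Qed.

Lemma splits_mirror g x y z p q : splits g x y z p q -> splits (mirror g) (- z) (- y) (- x) p (- q).
Proof.
  unfold splits. setoid_rewrite below3_mirror. setoid_rewrite above3_mirror. intuition.
Qed.

Lemma clusters_mirror g x c (n : nat -> nat) : clusters (fun j => iter g (n j) x) c ->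
  clusters (fun j => iter (mirror g) (n j) (- x)) (- c).
Proof.
  intros H eps He. eapply freq_impl; [|exact (H eps He)]. intros k Hk. cbv beta in *.
  rewrite iter_mirror_opp. replace (- iter g (n k) x - - c) with (- (iter g (n k) x - c)) by ring.
  now rewrite Rabs_Ropp.
Qed.

Lemma no_late_visit g X Y Z p h w a d q q2 : good g -> (1 <= p)%nat ->
  iter g (p * (2 * h + 1)) w = Y -> iter g p q = q -> splits g X Y Z p q ->
  clusters (fun j => iter g (4 * p * j) X) a -> clusters (fun j => iter g (4 * p * j) Z) d ->
  a < w < d -> splits g X Y Z (2 * p) q2 -> False.
Proof.
  intros Hg Hp Hw Hq [Hs|Hs] Ha Hd Haw Hs2.
  - now apply (no_late_visit_left g X Y Z p h w a d q q2).
  - apply (no_late_visit_left (mirror g) (- Z) (- Y) (- X) p h (- w) (- d) (- a) (- q) (- q2)).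
    + now apply good_mirror.
    + exact Hp.
    + now rewrite iter_mirror_opp, Hw.
    + now rewrite iter_mirror_opp, Hq.
    + setoid_rewrite below3_mirror. setoid_rewrite above3_mirror. exact Hs.
    + now apply clusters_mirror.
    + now apply clusters_mirror.
    + lra.
    + now apply splits_mirror.
Qed.

(** Supplies the period [2 ^ m] of which a given delay is an odd multiple, as [no_late_visit]
    requires. *)
Lemma two_adic_part M : forall n, ~ Nat.divide (2 ^ M) n ->
  exists m h, (m < M)%nat /\ n = (2 ^ m * (2 * h + 1))%nat.
Proof.
  induction M as [|M IH]; intros n Hn.
  - destruct Hn. exists n. simpl. lia.
  - destruct (Nat.Even_or_Odd n) as [[k Hk]|[k Hk]].
    + destruct (IH k) as [m [h [Hm Hh]]].
      * intros [l Hl]. apply Hn. exists l. rewrite Hk, Hl. simpl. lia.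
      * exists (S m), h. split; [lia|]. rewrite Hk, Hh. simpl. lia.
    + exists 0%nat, k. split; [lia|]. simpl. lia.
Qed.

(** If two visits differed by an odd multiple of [2 ^ M], all three orbits would be on opposite
    sides of some [q]. But the hypothesis on [W], used both ways, puts [x] at either visit below [z]
    at the other. *)
Lemma visits_congruent g x y z (W : nat -> Prop) :
  (forall p, (1 <= p)%nat ->
     evt (fun r => exists q, iter g p q = q /\
       splits g (iter g r x) (iter g r y) (iter g r z) p q)) ->
  (forall k l, W k -> W l -> iter g k x < iter g l z) ->
  forall M, exists N, forall k l, (N <= k)%nat -> (k <= l)%nat -> W k -> W l ->
    exists j, l = (k + 2 ^ M * j)%nat.
Proof.
  intros Hsep HW M. induction M as [|M [N IH]].
  - exists 0%nat. intros k l _ Hkl _ _. exists (l - k)%nat. simpl. lia.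
  - destruct (Hsep (2 ^ M)%nat) as [N' HN'].
    { pose proof (Nat.pow_nonzero 2 M). lia. }
    exists (Nat.max N N'). intros k l Hk Hkl Wk Wl.
    destruct (IH k l) as [j Hj]; [lia|assumption..|].
    destruct (Nat.Even_or_Odd j) as [[i Hi]|[i Hi]].
    + exists i. rewrite Hj, Hi. simpl. ring.
    + exfalso. destruct (HN' k) as [q [_ Hq]]; [lia|].
      unfold splits in Hq. setoid_rewrite below3_shift in Hq. setoid_rewrite above3_shift in Hq.
      assert (El : (2 ^ M + 2 * 2 ^ M * i + k = l)%nat) by (rewrite Hj, Hi; ring).
      pose proof (HW k l Wk Wl). pose proof (HW l k Wl Wk).
      destruct Hq as [Hq|Hq]; destruct (Hq i) as [_ Hl]; destruct (Hq 0%nat) as [Hk0 _];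
        rewrite El in Hl; rewrite Nat.mul_0_r in Hk0; change (0 + k)%nat with k in Hk0;
        unfold below3, above3 in *; lra.
Qed.

Lemma evt_bounded (P : nat -> nat -> Prop) n : (forall m, (m < n)%nat -> evt (P m)) ->
  evt (fun k => forall m, (m < n)%nat -> P m k).
Proof.
  induction n as [|n IH]; intros H.
  - exists 0%nat. intros; lia.
  - destruct IH as [N HN]; [intros; apply H; lia|]. destruct (H n (le_n _)) as [N' HN'].
    exists (Nat.max N N'). intros k Hk m Hm. destruct (Nat.eq_dec m n) as [->|].
    + apply HN'. lia.
    + apply HN; lia.
Qed.

(** First [a] is the lower limit of [x] along [V]; then [d] is the lower limit of [z] along the
    times of [V] at which [x] is close to [a], with tolerance [/ INR (S n)]. *)
Lemma joint_cluster g x z (V : nat -> Prop) : bdd g x -> bdd g z -> freq V ->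
  exists a d, forall eps, 0 < eps ->
    freq (fun k => V k /\ Rabs (iter g k x - a) < eps /\ Rabs (iter g k z - d) < eps).
Proof.
  intros [M HM] [M' HM'] HV.
  destruct (filter_liminf (fun n k => (n <= k)%nat /\ V k) (fun k => iter g k x) M)
    as [a [Ha1 Ha2]]; [exact HV|intros n m k Hnm [H1 H2]; split; [lia|exact H2]|exact HM|].
  destruct (filter_liminf (fun n k => ((n <= k)%nat /\ V k) /\ Rabs (iter g k x - a) < / INR (S n))
    (fun k => iter g k z) M') as [d [Hd1 Hd2]].
  - intros n. assert (Hpos : 0 < / INR (S n)) by apply Rinv_0_lt_compat, lt_0_INR, Nat.lt_0_succ.
    destruct (Ha1 _ Hpos) as [m Hm]. destruct (Ha2 _ Hpos (Nat.max m n)) as [k [[Hk Vk] Hka]].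
    exists k. split; [split; [lia|exact Vk]|].
    assert (a - / INR (S n) < iter g k x) by (apply Hm; split; [lia|exact Vk]).
    apply Rabs_def1; lra.
  - intros n m k Hnm [[Hk Vk] Hka]. split; [split; [lia|exact Vk]|].
    eapply Rlt_le_trans; [exact Hka|]. apply Rinv_le_contravar; [apply lt_0_INR; lia|].
    apply le_INR. lia.
  - exact HM'.
  - exists a, d. intros eps He N.
    destruct (Hd1 eps He) as [n1 Hn1].
    destruct (archimed_cor1 eps He) as [n2 [Hn2 Hn2']].
    destruct (Hd2 eps He (Nat.max N (Nat.max n1 n2))) as [k [[[Hk Vk] Hka] Hkd]].
    assert (Hinv : forall n, (n <= Nat.max N (Nat.max n1 n2))%nat ->
      / INR (S (Nat.max N (Nat.max n1 n2))) <= / INR (S n)).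
    { intros n Hn. apply Rinv_le_contravar; [apply lt_0_INR; lia|]. apply le_INR. lia. }
    exists k. split; [lia|]. split; [exact Vk|]. split.
    + eapply Rlt_trans; [exact Hka|]. eapply Rle_lt_trans; [|exact Hn2].
      apply Rinv_le_contravar; [apply lt_0_INR; lia|]. apply le_INR. lia.
    + assert (d - eps < iter g k z).
      { apply Hn1. split; [split; [lia|exact Vk]|]. pose proof (Hinv n1 ltac:(lia)). lra. }
      apply Rabs_def1; lra.
Qed.

Lemma not_freq_ordered g x y z c : proximal_triple g x y z -> 0 < c ->
  ~ freq (fun k => iter g k x + c < iter g k y /\ iter g k y + c < iter g k z).
Proof.
  intros HC Hc HV. pose proof HC as [Hg [[Bx [By Bz]] _]].
  destruct (joint_cluster g x z _ Bx Bz HV) as [a [d Hjc]].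
  (* The tolerance [c / 2] puts the middle orbit strictly between [a] and [d] at every such time,
     and the first orbit at one of them below the third at any other. *)
  set (W k := (iter g k x + c < iter g k y /\ iter g k y + c < iter g k z) /\
    Rabs (iter g k x - a) < c / 2 /\ Rabs (iter g k z - d) < c / 2).
  assert (HW : freq W) by (apply Hjc; lra).
  assert (HWy : forall k, W k -> a < iter g k y < d).
  { intros k [H1 [H2 H3]]. apply Rabs_def2 in H2. apply Rabs_def2 in H3. lra. }
  assert (HWxz : forall k l, W k -> W l -> iter g k x < iter g l z).
  { intros k l [H1 [H2 H3]] [H4 [H5 H6]].
    apply Rabs_def2 in H2. apply Rabs_def2 in H3. apply Rabs_def2 in H5. apply Rabs_def2 in H6.
    lra. }
  assert (Hsep : forall p, (1 <= p)%nat ->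
    evt (fun r => exists q, iter g p q = q /\
      splits g (iter g r x) (iter g r y) (iter g r z) p q))
    by (intros p Hp; now apply evt_splits).
  (* Two early visits less than [2 ^ M] apart: a later visit [r] cannot be congruent to both modulo
     [2 ^ M]. *)
  destruct (HW 0%nat) as [k1 [_ W1]]. destruct (HW (S k1)) as [k2 [Hk2 W2]].
  assert (HM : exists M, (k2 < 2 ^ M)%nat) by (exists k2; apply Nat.pow_gt_lin_r; lia).
  destruct HM as [M HM].
  assert (Hpow : forall m, (1 <= 2 ^ m)%nat).
  { intros m. pose proof (Nat.pow_nonzero 2 m). lia. }
  (* The exponent makes late visits congruent modulo [4 * 2 ^ m] for each [m < M], the spacing of
     the cluster sequences in [no_late_visit]. Splitting is then needed at both levels [m] and
     [S m], hence up to [M]. *)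
  destruct (visits_congruent g x y z W Hsep HWxz (M + 2)) as [N1 HN1].
  destruct (evt_bounded _ (M + 1) (fun m _ => Hsep (2 ^ m)%nat (Hpow m))) as [N2 HN2].
  destruct (HW (Nat.max k2 (Nat.max N1 N2))) as [r [Hr Wr]].
  assert (Hk : exists k, (k <= r)%nat /\ W k /\ ~ Nat.divide (2 ^ M) (r - k)).
  { destruct (classic (Nat.divide (2 ^ M) (r - k2))) as [[u Hu]|H2].
    - exists k1. split; [lia|]. split; [exact W1|]. intros [v Hv].
      clear - Hk2 HM Hr Hu Hv. generalize dependent (2 ^ M)%nat. intros P HP Hu Hv.
      assert (E : (v * P = u * P + (k2 - k1))%nat) by (rewrite <- Hu, <- Hv; lia).
      assert (u < v \/ v <= u)%nat as [Huv|Huv] by lia; nia.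
    - exists k2. split; [lia|]. now split. }
  destruct Hk as [k [Hkr [Wk Hdiv]]].
  destruct (two_adic_part M _ Hdiv) as [m [h [Hm Hh]]].
  destruct (HN2 r ltac:(lia) m ltac:(lia)) as [q [Hq Hs]].
  destruct (HN2 r ltac:(lia) (S m) ltac:(lia)) as [q2 [_ Hs2]].
  assert (Hcl : forall u e,
     (forall eps, 0 < eps -> freq (fun l => W l /\ Rabs (iter g l u - e) < eps)) ->
     clusters (fun j => iter g (4 * 2 ^ m * j) (iter g r u)) e).
  { intros u e H eps He N.
    destruct (H eps He (r + 4 * 2 ^ m * N)%nat) as [l [Hl [Wl Hle]]].
    destruct (HN1 r l) as [j Hj]; [lia|lia|assumption..|].
    assert (E : (2 ^ (M + 2) * j = 4 * 2 ^ m * (2 ^ (M - m) * j))%nat).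
    { replace (M + 2)%nat with (m + (M - m) + 2)%nat by lia.
      rewrite !Nat.pow_add_r. simpl. ring. }
    exists (2 ^ (M - m) * j)%nat. split.
    - apply (Nat.mul_le_mono_pos_l _ _ (4 * 2 ^ m)); [specialize (Hpow m); lia|]. lia.
    - rewrite <- iter_plus. replace (4 * 2 ^ m * (2 ^ (M - m) * j) + r)%nat with l by lia.
      exact Hle. }
  assert (HWe : forall eps, 0 < eps -> freq (fun l => W l /\
     Rabs (iter g l x - a) < eps /\ Rabs (iter g l z - d) < eps)).
  { intros eps He.
    eapply freq_impl; [|exact (Hjc (Rmin eps (c / 2)) 
      (Rmin_glb_lt _ _ _ He (Rdiv_lt_0_compat _ _ Hc Rlt_0_2)))].
    intros l [Vl [H1 H2]]. pose proof (Rmin_l eps (c / 2)). pose proof (Rmin_r eps (c / 2)).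
    unfold W. repeat split; try apply Vl; lra. }
  apply (no_late_visit g (iter g r x) (iter g r y) (iter g r z) (2 ^ m) h
    (iter g k y) a d q q2); auto.
  - rewrite <- Hh, <- iter_plus. f_equal. lia.
  - apply Hcl. intros eps He. eapply freq_impl; [|exact (HWe eps He)].
    intros l [H1 [H2 _]]. now split.
  - apply Hcl. intros eps He. eapply freq_impl; [|exact (HWe eps He)].
    intros l [H1 [_ H3]]. now split.
Qed.

(** * Triples of proximal orbits *)

Lemma ap_limit_fixed g x t l : continuity g -> Un_cv (fun j => iter g (t * j) x) l ->
  iter g t l = l.
Proof.
  intros Hg Hl. apply (UL_sequence (fun j => iter g (t * (j + 1)) x)).
  - apply Un_cv_ext with (fun j => iter g t (iter g (t * j) x)).
    + intros j. rewrite <- iter_plus. f_equal. ring.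
    + apply Un_cv_continuity; [now apply iter_continuity|exact Hl].
  - exact (CV_shift' (fun j => iter g (t * j) x) 1 l Hl).
Qed.

(** The limit of [x] along multiples of [t] is a fixed point of [g ^ t] at which [y] clusters, which
    [fixed_not_cluster] allows only for asymptotically periodic [y]. *)
Lemma proximal_ap g x y : good g -> bdd g x -> bdd g y -> proximal g x y ->
  asymp_periodic g x -> asymp_periodic g y.
Proof.
  intros Hg Hbx Hby Hp [t [l [Ht Hl]]]. apply NNPP. intros Hn.
  pose proof (ap_limit_fixed g x t l (proj1 Hg) Hl) as Hfix.
  apply (fixed_not_cluster (iter g t) y l); [now apply good_iter|now apply bdd_iter| |exact Hfix|].
  - intros H. now apply Hn, (ap_iter g y t Ht).
  - intros eps He N. destruct (Hl (eps / 2) ltac:(lra)) as [N' HN'].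
    destruct (proximal_iter_shift g x y t 0 (proj1 Hg) Hbx Hby Ht Hp (eps / 2) ltac:(lra)
      (Nat.max N N')) as [k [Hk Hxy]].
    exists k. split; [lia|]. specialize (HN' k ltac:(lia)).
    rewrite !iter_mult, (Nat.mul_comm k t) in *. unfold Rdist in HN'.
    change (iter g 0 x) with x in Hxy. change (iter g 0 y) with y in Hxy.
    apply Rabs_def2 in Hxy. apply Rabs_def2 in HN'. apply Rabs_def1; lra.
Qed.

Lemma continuity_window g l n eps : continuity g -> 0 < eps ->
  exists d, 0 < d /\ forall i u, (i <= n)%nat -> Rabs (u - l) < d ->
    Rabs (iter g i u - iter g i l) < eps.
Proof.
  intros Hg He. induction n as [|n [d [Hd IH]]].
  - exists eps. split; [exact He|]. intros i u Hi Hu. now replace i with 0%nat by lia.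
  - destruct (continuity_eps (iter g (S n)) l eps (iter_continuity g _ Hg) He) as [d' [Hd' H']].
    exists (Rmin d d'). split; [now apply Rmin_glb_lt|]. intros i u Hi Hu.
    destruct (Nat.eq_dec i (S n)) as [->|].
    + apply H'. eapply Rlt_le_trans; [exact Hu|apply Rmin_r].
    + apply IH; [lia|]. eapply Rlt_le_trans; [exact Hu|apply Rmin_l].
Qed.

Lemma Un_cv_subseq (u : nat -> R) l s : (1 <= s)%nat -> Un_cv u l -> Un_cv (fun j => u (s * j)%nat) l.
Proof.
  intros Hs Hu eps He. destruct (Hu eps He) as [N HN]. exists N. intros n Hn. apply HN. nia.
Qed.

(** Along multiples of a common period both orbits converge, by proximality to the same limit;
    continuity over one period extends this to all times. *)
Lemma proximal_ap_asymptotic g x y : good g -> bdd g x -> bdd g y -> proximal g x y ->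
  asymp_periodic g x -> asymp_periodic g y ->
  forall eps, 0 < eps -> evt (fun k => Rabs (iter g k x - iter g k y) < eps).
Proof.
  intros Hg Hbx Hby Hp [t1 [l1 [Ht1 Hl1]]] [t2 [l2 [Ht2 Hl2]]] eps He.
  set (t := (t1 * t2)%nat). assert (Ht : (1 <= t)%nat) by (unfold t; nia).
  assert (H1 : Un_cv (fun j => iter g (t * j) x) l1).
  { apply Un_cv_ext with (2 := Un_cv_subseq _ _ _ Ht2 Hl1). intros j. f_equal. unfold t. ring. }
  assert (H2 : Un_cv (fun j => iter g (t * j) y) l2).
  { apply Un_cv_ext with (2 := Un_cv_subseq _ _ _ Ht1 Hl2). intros j. f_equal. unfold t. ring. }
  assert (E : l1 = l2).
  { apply cond_eq. intros e He'.
    destruct (H1 (e / 3) ltac:(lra)) as [N1 HN1]. destruct (H2 (e / 3) ltac:(lra)) as [N2 HN2].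
    destruct (proximal_iter_shift g x y t 0 (proj1 Hg) Hbx Hby Ht Hp (e / 3) ltac:(lra)
      (Nat.max N1 N2)) as [k [Hk Hxy]].
    specialize (HN1 k ltac:(lia)). specialize (HN2 k ltac:(lia)).
    rewrite !iter_mult, (Nat.mul_comm k t) in Hxy. unfold Rdist in *.
    change (iter g 0 x) with x in Hxy. change (iter g 0 y) with y in Hxy.
    apply Rabs_def2 in Hxy. apply Rabs_def2 in HN1. apply Rabs_def2 in HN2.
    apply Rabs_def1; lra. }
  subst l2. destruct (continuity_window g l1 t (eps / 2) (proj1 Hg)) as [d [Hd Hdw]]; [lra|].
  destruct (H1 d Hd) as [N1 HN1]. destruct (H2 d Hd) as [N2 HN2].
  exists (t * S (Nat.max N1 N2))%nat. intros k Hk.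
  pose proof (Nat.div_mod_eq k t) as Hdm.
  pose proof (Nat.mod_upper_bound k t ltac:(lia)) as Hmod.
  assert (Hj : (Nat.max N1 N2 <= k / t)%nat) by nia.
  specialize (HN1 (k / t)%nat ltac:(lia)). specialize (HN2 (k / t)%nat ltac:(lia)).
  unfold Rdist in *.
  apply (Hdw (k mod t)%nat) in HN1; [|lia]. apply (Hdw (k mod t)%nat) in HN2; [|lia].
  rewrite <- iter_plus in HN1, HN2. rewrite Nat.add_comm, <- Hdm in HN1, HN2.
  apply Rabs_def2 in HN1. apply Rabs_def2 in HN2. apply Rabs_def1; lra.
Qed.

Lemma freq_or (P Q : nat -> Prop) : freq (fun k => P k \/ Q k) -> freq P \/ freq Q.
Proof.
  intros H. destruct (classic (freq P)) as [|HP]; [now left|right].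
  eapply freq_impl; [|exact (freq_evt _ _ H (not_freq _ HP))].
  intros k [[H1|H1] H2]; [contradiction|exact H1].
Qed.

Lemma no_scrambled_triple g x y z c : good g -> bdd g x -> bdd g y -> bdd g z ->
  proximal g x y -> proximal g x z -> proximal g y z -> 0 < c ->
  ~ freq (fun k => c < Rabs (iter g k x - iter g k y) /\
     c < Rabs (iter g k x - iter g k z) /\ c < Rabs (iter g k y - iter g k z)).
Proof.
  intros Hg Bx By Bz Pxy Pxz Pyz Hc HF.
  pose proof (proximal_sym _ _ _ Pxy) as Pyx. pose proof (proximal_sym _ _ _ Pxz) as Pzx.
  pose proof (proximal_sym _ _ _ Pyz) as Pzy.
  assert (Hnap : forall u v, bdd g u -> bdd g v -> proximal g u v ->
    freq (fun k => c < Rabs (iter g k u - iter g k v)) -> ~ asymp_periodic g u).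
  { intros u v Bu Bv Puv HFuv Au.
    pose proof (proximal_ap g u v Hg Bu Bv Puv Au) as Av.
    destruct (freq_evt _ _ HFuv (proximal_ap_asymptotic g u v Hg Bu Bv Puv Au Av c Hc) 0%nat)
      as [k [_ Hk]]. lra. }
  assert (Nx : ~ asymp_periodic g x).
  { apply (Hnap x y Bx By Pxy). eapply freq_impl; [|exact HF]. intros k Hk. apply Hk. }
  assert (Ny : ~ asymp_periodic g y).
  { apply (Hnap y z By Bz Pyz). eapply freq_impl; [|exact HF]. intros k Hk. apply Hk. }
  assert (Nz : ~ asymp_periodic g z).
  { intros Az. exact (Nx (proximal_ap g z x Hg Bz Bx Pzx Az)). }
  set (V u v w k := iter g k u + c < iter g k v /\ iter g k v + c < iter g k w).
  assert (HV : freq (fun k => V x y z k \/ V x z y k \/ V y x z k \/ V y z x k \/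
                              V z x y k \/ V z y x k)).
  { eapply freq_impl; [|exact HF]. unfold V. intros k [H1 [H2 H3]].
    revert H1 H2 H3. unfold Rabs. repeat destruct Rcase_abs; lra. }
  repeat (apply freq_or in HV; destruct HV as [HV|HV]); revert HV;
    apply not_freq_ordered; try exact Hc;
    unfold proximal_triple; auto 10.
Qed.

(** * Entropy and horseshoes *)

(* Words of length n in two [eps]-separated sets, each mapped by [f ^ p] onto a set
   containing both, give 2 ^ n points that are (n p, eps)-separated. *)
Lemma coding_positive_entropy f p eps (E C1 C2 : R -> Prop) e0 :
  (1 <= p)%nat -> 0 < eps -> E e0 ->
  (forall x, E x -> inI x) -> (forall x, C1 x -> E x) -> (forall x, C2 x -> E x) ->
  (forall y, E y -> exists x, C1 x /\ iter f p x = y) ->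
  (forall y, E y -> exists x, C2 x /\ iter f p x = y) ->
  (forall x y, C1 x -> C2 y -> Rabs (x - y) > eps) -> ~ zero_entropy f.
Proof.
  intros Hp He HE0 HEI HC1 HC2 Hcov1 Hcov2 Hsep HZ.
  assert (Hlift : forall C : R -> Prop, (forall y, E y -> exists x, C x /\ iter f p x = y) ->
    forall L, (forall y, In y L -> E y) -> exists L', (forall x, In x L' -> C x) /\
      map (iter f p) L' = L).
  { intros C HC L. induction L as [|y L IH]; intros HL.
    - exists nil. split; [intros x []|reflexivity].
    - destruct IH as [L' [H1 H2]]; [intros; apply HL; now right|].
      destruct (HC y) as [x [Hx Hxy]]; [apply HL; now left|].
      exists (x :: L'). split; [intros u [<-|Hu]; auto|]. simpl. now rewrite Hxy, H2. }
  (* Points with separated images are themselves separated, [p] steps later. *)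
  assert (Hpre : forall n L L', separated_set f (n * p) eps L ->
     map (iter f p) L' = L -> (forall x, In x L' -> E x) ->
     NoDup L' /\ forall x y, In x L' -> In y L' -> x <> y -> n_eps_sep f (S n * p) eps x y).
  { intros n L L' [HN [_ HS]] HL HE. split.
    - apply (NoDup_map_inv (iter f p)). now rewrite HL.
    - intros x y Hx Hy Hxy.
      assert (Hne : iter f p x <> iter f p y).
      { intros Eq. apply Hxy. rewrite <- HL in HN.
        clear - HN Eq Hx Hy. induction L' as [|u L' IH]; [destruct Hx|].
        simpl in HN. apply NoDup_cons_iff in HN. destruct HN as [Hu HN].
        destruct Hx as [->|Hx], Hy as [->|Hy]; auto.
        - destruct Hu. rewrite Eq. now apply in_map.
        - destruct Hu. rewrite <- Eq. now apply in_map. }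
      destruct (HS (iter f p x) (iter f p y)) as [k [Hk Hk2]];
        [rewrite <- HL; now apply in_map..|exact Hne|].
      exists (k + p)%nat. split; [lia|]. now rewrite !iter_plus. }
  assert (Hwords : forall n, exists L, length L = (2 ^ n)%nat /\ (forall x, In x L -> E x) /\
    separated_set f (n * p) eps L).
  { induction n as [|n [L [HL [HLE HLS]]]].
    - exists (e0 :: nil). split; [reflexivity|]. split; [intros x [<-|[]]; exact HE0|].
      split; [constructor; [intros []|constructor]|]. split.
      + intros x [<-|[]]. now apply HEI.
      + intros x y [<-|[]] [<-|[]] H. now destruct H.
    - destruct (Hlift C1 Hcov1 L HLE) as [L1 [H1 M1]].
      destruct (Hlift C2 Hcov2 L HLE) as [L2 [H2 M2]].
      destruct (Hpre n L L1 HLS M1) as [N1 S1]; [auto|].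
      destruct (Hpre n L L2 HLS M2) as [N2 S2]; [auto|].
      exists (L1 ++ L2). split; [|split; [|split; [|split]]].
      + rewrite length_app, <- (length_map (iter f p) L1), <- (length_map (iter f p) L2), M1, M2, HL.
        simpl. lia.
      + intros x Hx. apply in_app_or in Hx. destruct Hx; auto.
      + apply NoDup_app; [exact N1|exact N2|]. intros x Hx1 Hx2.
        pose proof (Hsep x x (H1 x Hx1) (H2 x Hx2)) as H.
        rewrite Rminus_diag, Rabs_R0 in H. lra.
      + intros x Hx. apply in_app_or in Hx. destruct Hx; auto.
      + intros x y Hx Hy Hxy. apply in_app_or in Hx. apply in_app_or in Hy.
        destruct Hx as [Hx|Hx], Hy as [Hy|Hy]; auto.
        * exists 0%nat. split; [nia|]. apply Hsep; auto.
        * exists 0%nat. split; [nia|]. rewrite Rabs_minus_sym. apply Hsep; auto. }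
  assert (HpR : 1 <= INR p) by (rewrite <- INR_1; now apply le_INR).
  assert (Hln : 0 < ln 2) by (rewrite <- ln_1; apply ln_increasing; lra).
  (* The [2 ^ n] points separated within time [n * p] give growth rate at least ln 2 / p, and half
     of that rate is refuted. Taking [n = S N] keeps the exponent positive, so the comparison is
     strict. *)
  destruct (HZ eps He (ln 2 / (2 * INR p))) as [N HN].
  { apply Rdiv_lt_0_compat; lra. }
  destruct (Hwords (S N)) as [L [HL [_ HS]]].
  specialize (HN (S N * p)%nat ltac:(nia) L HS).
  rewrite HL, pow_INR, mult_INR in HN.
  replace (ln 2 / (2 * INR p) * (INR (S N) * INR p)) with (INR (S N) * (ln 2 / 2)) in HN
    by (field; lra).
  change (INR 2) with 2 in HN. rewrite <- Rpower_pow in HN by lra. unfold Rpower in HN.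
  apply Rle_not_lt in HN. apply HN, exp_increasing.
  pose proof (lt_0_INR (S N) ltac:(lia)). nra.
Qed.

(** The two halves meet at [c], whereas the coding needs sets at positive distance. If [F] fixes
    [c], the right half can be cut back to [m, e2] with [c < m] and still stretch over [e1, e2]. If
    not, [F] is applied twice, and only the points that [F] keeps in their own half are used. *)
Lemma zero_entropy_no_horseshoe f g : zero_entropy f -> continuity g ->
  (forall x, inI (g x)) -> (forall k x, inI x -> iter g k x = iter f k x) -> no_horseshoe g.
Proof.
  intros HZ Hg HI Hfg e1 e2 c s t p1 q1 p2 q2 He Hp1 Hq1 Hp2 Hq2 H1 H2 H3 H4.
  assert (Hc1 : e1 < c).
  { apply Rnot_le_lt. intros H. assert (E : p1 = q1) by lra. rewrite E in H1. lra. }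
  assert (Hc2 : c < e2).
  { apply Rnot_le_lt. intros H. assert (E : p2 = q2) by lra. rewrite E in H3. lra. }
  assert (HI' : forall x, inI (iter g s x)).
  { intros x. destruct s as [|s]; [|apply HI]. change (e2 <= q1) in H2. lra. }
  assert (HEI : forall x, e1 <= x <= e2 -> inI x).
  { intros x Hx. pose proof (HI' p1) as A1. pose proof (HI' q1) as A2. unfold inI in *. lra. }
  assert (Hst : (1 <= s + t)%nat).
  { destruct s; [change (e2 <= q1) in H2; lra|lia]. }
  assert (Hcov : forall n p q a b, a <= p <= b -> a <= q <= b -> iter g n p <= e1 ->
     e2 <= iter g n q -> forall y, e1 <= y <= e2 -> exists x, a <= x <= b /\ iter g n x = y).
  { intros n p q a b Hp Hq Hpn Hqn y Hy.
    destruct (ivt (iter g n) p q y (iter_continuity g n Hg)) as [x [Hx Hxy]]; [lra|lra|].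
    exists x. split; [|exact Hxy]. revert Hx. unfold Rmin, Rmax. destruct Rle_dec; lra. }
  pose proof (Hcov s p1 q1 e1 c Hp1 Hq1 H1 H2) as CL.
  pose proof (Hcov t p2 q2 c e2 Hp2 Hq2 H3 H4) as CR.
  set (F := iter g (s + t)).
  assert (FL : forall y, e1 <= y <= e2 -> exists x, e1 <= x <= c /\ F x = y).
  { intros y Hy. destruct (CR y Hy) as [x [Hx Hxy]]. destruct (CL x) as [w [Hw Hwx]]; [lra|].
    exists w. split; [exact Hw|]. unfold F. now rewrite Nat.add_comm, iter_plus, Hwx. }
  assert (FR : forall y, e1 <= y <= e2 -> exists x, c <= x <= e2 /\ F x = y).
  { intros y Hy. destruct (CL y Hy) as [x [Hx Hxy]]. destruct (CR x) as [w [Hw Hwx]]; [lra|].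
    exists w. split; [exact Hw|]. unfold F. now rewrite iter_plus, Hwx. }
  destruct (Req_dec (F c) c) as [Hfix|Hnfix].
  - destruct (FR e1) as [r1 [Hr1 Hr1']]; [lra|]. destruct (FR e2) as [r2 [Hr2 Hr2']]; [lra|].
    assert (r1 <> c) by (intros ->; lra). assert (r2 <> c) by (intros ->; lra).
    set (m := Rmin r1 r2). assert (Hm : c < m) by (apply Rmin_glb_lt; lra).
    assert (m <= r1) by apply Rmin_l. assert (m <= r2) by apply Rmin_r.
    apply (coding_positive_entropy f (s + t) ((m - c) / 2) (fun x => e1 <= x <= e2)
      (fun x => e1 <= x <= c) (fun x => m <= x <= e2) c); try assumption; try lra.
    + intros; lra.
    + intros; lra.
    + intros y Hy. destruct (FL y Hy) as [x [Hx Hxy]]. exists x. split; [exact Hx|].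
      rewrite <- Hfg; [exact Hxy|]. apply HEI. lra.
    + intros y Hy. destruct (Hcov (s + t)%nat r1 r2 m e2) with (y := y) as [x [Hx Hxy]];
        [lra|lra|fold F; lra|fold F; lra|exact Hy|].
      exists x. split; [exact Hx|]. rewrite <- Hfg; [exact Hxy|]. apply HEI. lra.
    + intros x y Hx Hy. rewrite Rabs_left1; lra.
  - destruct (continuity_eps F c (Rabs (F c - c)) (iter_continuity g _ Hg)) as [d [Hd Hcd]].
    { apply Rabs_pos_lt. lra. }
    assert (HFF : forall x, e1 <= x <= e2 -> iter f (s + t + (s + t)) x = F (F x)).
    { intros x Hx. rewrite <- Hfg; [|now apply HEI]. now rewrite iter_plus. }
    apply (coding_positive_entropy f (s + t + (s + t)) (d / 2) (fun x => e1 <= x <= e2)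
      (fun x => e1 <= x <= c /\ e1 <= F x <= c) (fun x => c <= x <= e2 /\ c <= F x <= e2) c);
      try assumption; try lra.
    + lia.
    + intros; lra.
    + intros; lra.
    + intros y Hy. destruct (FL y Hy) as [w [Hw Hwy]]. destruct (FL w) as [x [Hx Hxw]]; [lra|].
      exists x. split; [lra|]. rewrite HFF; [now rewrite Hxw|lra].
    + intros y Hy. destruct (FR y Hy) as [w [Hw Hwy]]. destruct (FR w) as [x [Hx Hxw]]; [lra|].
      exists x. split; [lra|]. rewrite HFF; [now rewrite Hxw|lra].
    + intros x y [Hx HFx] [Hy HFy].
      (* Were they closer, both would be within [d] of [c], so [F x] and [F y] would be strictly on
         the same side of [c]. *)
      assert (Hxy : d <= y - x).
      { apply Rnot_lt_le. intros Hlt.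
        assert (Hxc : Rabs (x - c) < d) by (apply Rabs_def1; lra).
        assert (Hyc : Rabs (y - c) < d) by (apply Rabs_def1; lra).
        apply Hcd, Rabs_def2 in Hxc. apply Hcd, Rabs_def2 in Hyc.
        revert Hxc Hyc. unfold Rabs. destruct Rcase_abs; lra. }
      rewrite Rabs_left1; lra.
Qed.

(** * Extension of the map to the line, and conclusion *)

(** The retraction of the line onto I: composing [f] with it gives a map continuous on the whole
    line whose orbits from I are those of [f]. *)
Definition clamp (x : R) := Rmax 0 (Rmin 1 x).

Lemma clamp_inI x : inI (clamp x).
Proof. unfold inI, clamp, Rmax, Rmin. destruct (Rle_dec 1 x); destruct Rle_dec; lra. Qed.

Lemma clamp_id x : inI x -> clamp x = x.
Proof. unfold inI, clamp. intros H. rewrite Rmin_right, Rmax_right; lra. Qed.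

Lemma clamp_contract x y : Rabs (clamp y - clamp x) <= Rabs (y - x).
Proof.
  unfold clamp, Rmax, Rmin.
  destruct (Rle_dec 1 x); destruct (Rle_dec 1 y); repeat destruct Rle_dec;
    unfold Rabs; repeat destruct Rcase_abs; lra.
Qed.

Lemma continuity_clamped f : cont_self_map_I f -> continuity (fun x => f (clamp x)).
Proof.
  intros [_ Hf] x eps He. destruct (Hf (clamp x) (clamp_inI x) eps He) as [d [Hd Hcd]].
  exists d. split; [exact Hd|]. intros y [_ Hy]. apply Hcd; [apply clamp_inI|].
  eapply Rle_lt_trans; [apply clamp_contract|exact Hy].
Qed.

Lemma iter_inI f k x : cont_self_map_I f -> inI x -> inI (iter f k x).
Proof. intros [HI _] Hx. induction k as [|k IH]; [exact Hx|]. exact (HI _ IH). Qed.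

Lemma iter_clamped f k x : cont_self_map_I f -> inI x ->
  iter (fun x => f (clamp x)) k x = iter f k x.
Proof.
  intros Hf Hx. induction k as [|k IH]; [reflexivity|].
  change (f (clamp (iter (fun x => f (clamp x)) k x)) = f (iter f k x)).
  rewrite IH, clamp_id; [reflexivity|]. now apply iter_inI.
Qed.

Theorem mainTheorem14 (f : R -> R) :
  cont_self_map_I f -> zero_entropy f ->
  ~ (exists x1 x2 x3 : R, scrambled3 f x1 x2 x3).
Proof.
  intros Hf HZ [x [y [z [Ix [Iy [Iz [Hmax [c [Hc Hmin]]]]]]]]].
  set (g := fun t => f (clamp t)).
  assert (Hfg : forall k u, inI u -> iter g k u = iter f k u)
    by (intros k u Hu; now apply iter_clamped).
  assert (Hg : good g).
  { split; [now apply continuity_clamped|].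
    apply (zero_entropy_no_horseshoe f g HZ); [now apply continuity_clamped| |exact Hfg].
    intros u. apply Hf, clamp_inI. }
  assert (Hb : forall u, inI u -> bdd g u).
  { intros u Hu. exists 1. intros k. rewrite Hfg by exact Hu.
    destruct (iter_inI f k u Hf Hu). rewrite Rabs_right; lra. }
  assert (Hp : forall u v, inI u -> inI v ->
    (forall k, Rabs (iter f k u - iter f k v) <= dmax3 f k x y z) -> proximal g u v).
  { intros u v Hu Hv H eps He N. destruct (Hmax eps He N) as [k [Hk Hke]].
    exists k. split; [exact Hk|]. rewrite !Hfg by assumption.
    eapply Rle_lt_trans; [apply H|exact Hke]. }
  apply (no_scrambled_triple g x y z c Hg); auto.
  - apply Hp; auto. intros k. apply Rmax_l.
  - apply Hp; auto. intros k. eapply Rle_trans; [|apply Rmax_r]. apply Rmax_l.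
  - apply Hp; auto. intros k. eapply Rle_trans; [|apply Rmax_r]. apply Rmax_r.
  - intros N. destruct (Hmin N) as [k [Hk Hkc]]. exists k. split; [exact Hk|].
    rewrite !Hfg by assumption. unfold dmin3 in Hkc.
    pose proof (Rlt_le_trans _ _ _ Hkc (Rmin_l _ _)).
    pose proof (Rlt_le_trans _ _ _ Hkc (Rmin_r _ _)) as Hr.
    pose proof (Rlt_le_trans _ _ _ Hr (Rmin_l _ _)).
    pose proof (Rlt_le_trans _ _ _ Hr (Rmin_r _ _)). auto.
Qed.
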